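(* Let $\mathrm{UOG}$ be the uniform odd subgraph measure on $\mathbb{Z}^2$, and let $\mathrm{UOG}_{\mathrm{hp}}$ be its marginal on the upper half-plane $\mathbb{Z}\times\mathbb{Z}_{\ge 0}$. Then almost surely $\mathrm{UOG}_{\mathrm{hp}}$ has no infinite cluster.
   Context: Here $\mathbb{Z}^2$ denotes the square lattice graph: the Cayley graph of the group $\mathbb{Z}^2$ with generators $(1,0),(0,1)$, with edge set $E(\mathbb{Z}^2)$. A (spanning) subgraph corresponds to $\omega\in\{0,1\}^{E(\mathbb{Z}^2)}$, where $\omega_e=1$ means $e$ is open (present) and $\omega_e=0$ means $e$ is closed. A cluster is a connected component of the subgraph of open edges; it is infinite if it has infinitely many vertices. The marginal on the upper half-plane is the law of $\omega$ restricted to edges with both endpoints in $\mathbb{Z}\times\mathbb{Z}_{\ge 0}$. A subgraph is even (respectively, odd) if all vertices have even (respectively, odd) degree in it. The even subgraphs of $\mathbb{Z}^2$ form a closed subgroup of $\{0,1\}^{E(\mathbb{Z}^2)}\cong(\mathbb{Z}/2\mathbb{Z})^{E(\mathbb{Z}^2)}$; the uniform even subgraph measure $\mathrm{UEG}$ is the Haar probability measure on this compact subgroup. The uniform odd subgraph measure $\mathrm{UOG}$ is the law of the symmetric difference (XOR) of a fixed odd subgraph of $\mathbb{Z}^2$ (for instance a perfect matching) with a sample from $\mathrm{UEG}$; it does not depend on the choice of the fixed odd subgraph. Equivalently, $\mathrm{UEG}$ is obtained by assigning independent uniform signs in $\{-,+\}$ to the plaquettes (unit square faces) of $\mathbb{Z}^2$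 and declaring an edge open if and only if its two adjacent plaquettes have the same sign, and $\mathrm{UOG}$ is obtained from this by taking the symmetric difference with any fixed perfect matching. *)

(* Defs.v *)
From HB Require Import structures.
From mathcomp Require Import all_boot all_order all_algebra.
From mathcomp Require Import all_classical all_reals all_analysis.
From mathcomp Require Import zify.
From Stdlib Require Import Relation_Operators.

Set Implicit Arguments.
Unset Strict Implicit.
Unset Printing Implicit Defensive.

Import Order.TTheory GRing.Theory Num.Theory.

Local Open Scope classical_set_scope.
Local Open Scope ring_scope.

Definition vertex : Type := (int * int)%type.

Definition generator (d : bool) : vertex := if d then (0, 1) else (1, 0).

(* The edge joining v and v + generator d is encoded, once, as (v, d):
   d = false for horizontal edges, d = true for vertical ones. *)
Definition edge : Type := (vertex * bool)%type.

Definition source (e : edge) : vertex := e.1.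

Definition target (e : edge) : vertex := e.1 + generator e.2.

Definition incident_edges (v : vertex) : seq edge :=
  [:: (v, false); (v, true);
      (v - generator false, false); (v - generator true, true)].

Lemma mem_incident_edges (v : vertex) (e : edge) :
  (e \in incident_edges v) = (v == source e) || (v == target e).
Proof.
case: v e => a b [[c d] []]; rewrite /source /target /generator /= !inE;
  rewrite -!pair_eqE /= -?pair_eqE /=; lia.
Qed.

Lemma uniq_incident_edges (v : vertex) : uniq (incident_edges v).
Proof.
case: v => a b; rewrite /generator /= !inE -!pair_eqE /= -?pair_eqE /=; lia.
Qed.

(* The coordinate events generate the product sigma-algebra of {0,1}^E; for
   countable E this is the Borel sigma-algebra of the product topology. *)
Definition coordinate_events (E : Type) : set (set (E -> bool)) :=
  [set A | exists e : E, A = [set w : E -> bool | w e]].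

Definition config (E : Type) : Type :=
  g_sigma_algebraType (@coordinate_events E).

HB.instance Definition _ (E : Type) := Measurable.on (config E).

Lemma measurable_coordinate (E : Type) (e : E) :
  measurable_fun [set: config E] (fun w : config E => w e).
Proof.
apply: (measurable_fun_bool true); rewrite setTI.
by apply: sub_sigma_algebra; exists e.
Qed.

Lemma measurable_fun_config d (T : measurableType d) (E : Type)
    (f : T -> config E) :
  (forall e : E, measurable_fun [set: T] (fun x => f x e)) ->
  measurable_fun [set: T] f.
Proof.
move=> mf; pose G : set (set (config E)) := @coordinate_events E.
apply: (measurability G) => //.
move=> _ [_ [e ->] <-]; exact: (mf e measurableT [set true]).
Qed.

Definition degree (w : config edge) (v : vertex) : nat :=
  count w (incident_edges v).

Definition even_subgraph : set (config edge) :=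
  [set w | forall v, ~~ odd (degree w v)].

Definition odd_subgraph : set (config edge) :=
  [set w | forall v, odd (degree w v)].

Lemma measurable_even_subgraph : measurable even_subgraph.
Proof.
have maddb (f g : config edge -> bool) : measurable_fun setT f ->
    measurable_fun setT g -> measurable_fun setT (fun w => f w (+) g w).
  move=> mf mg.
  rewrite (_ : (fun w => _) = fun w => (f w && ~~ g w) || (~~ f w && g w)).
    by apply: measurable_or; apply: measurable_and => //; exact: measurable_neg.
  by apply/funext => w; case: (f w); case: (g w).
rewrite (_ : even_subgraph = \bigcap_n
    if (unpickle n : option (int * int)) is Some v
    then [set w | ~~ odd (degree w v)] else setT); last first.
  apply/seteqP; split => w /= ew.
    by move=> n _; case: (unpickle n) => // v; exact: ew.
  by move=> v; have := ew (pickle (v : int * int)) I; rewrite pickleK.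
apply: bigcapT_measurable => n; case: (unpickle n) => [v|//].
have md : measurable_fun setT (fun w : config edge => ~~ odd (degree w v)).
  apply: measurable_neg.
  rewrite (_ : (fun w => _) = fun w : config edge =>
      foldr (fun e b => w e (+) b) false (incident_edges v)).
    elim: (incident_edges v) => [|e s IH] /=; first exact: measurable_cst.
    exact: (maddb _ _ (measurable_coordinate e) IH).
  apply/funext => w; rewrite /degree; elim: (incident_edges v) => //= e s <-.
  by rewrite oddD oddb.
by have := md measurableT [set true] I; rewrite setTI.
Qed.

Definition symdiff (E : Type) (h w : config E) : config E :=
  fun e => h e (+) w e.

Lemma measurable_symdiff (E : Type) (h : config E) :
  measurable_fun [set: config E] (symdiff h).
Proof.
apply: measurable_fun_config => e; rewrite /symdiff.
have [|] := boolP (h e) => he.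
  rewrite (_ : (fun x => _) = (fun w : config E => ~~ w e)) //.
  exact: measurableT_comp (measurable_coordinate e).
exact: (measurable_coordinate e).
Qed.

HB.instance Definition _ (E : Type) (h : config E) :=
  isMeasurableFun.Build _ _ _ _ (symdiff h) (measurable_symdiff h).

(* The Haar probability measure of a subgroup H of (Z/2Z)^E, seen as a measure
   on the whole group (Z/2Z)^E. *)
Definition is_Haar_probability (R : realType) (E : Type) (H : set (config E))
    (P : probability (config E) R) : Prop :=
  P H = 1%E /\
  forall h, H h -> forall A, measurable A -> P (symdiff h @^-1` A) = P A.

Definition is_UEG (R : realType) (P : probability (config edge) R) : Prop :=
  is_Haar_probability even_subgraph P.

Definition is_UOG (R : realType) (Q : probability (config edge) R) : Prop :=
  exists (P : probability (config edge) R) (h : config edge),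
    [/\ is_UEG P, odd_subgraph h &
        forall A, measurable A -> Q A = distribution P (symdiff h) A].

Definition half_plane : set vertex := [set v | 0 <= v.2].

Definition hp_edge : Type :=
  {e : edge | half_plane (source e) /\ half_plane (target e)}.

Definition hp_restriction (w : config edge) : config hp_edge :=
  fun e => w (sval e).

Lemma measurable_hp_restriction :
  measurable_fun [set: config edge] hp_restriction.
Proof.
apply: measurable_fun_config => e; exact: (measurable_coordinate (sval e)).
Qed.

HB.instance Definition _ :=
  isMeasurableFun.Build _ _ _ _ hp_restriction measurable_hp_restriction.

Definition hp_marginal (R : realType) (Q : probability (config edge) R) :
    probability (config hp_edge) R :=
  distribution Q hp_restriction.

Definition hp_adjacent (w : config hp_edge) (u v : vertex) : Prop :=
  exists2 e : hp_edge, w e &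
    (u = source (sval e) /\ v = target (sval e)) \/
    (v = source (sval e) /\ u = target (sval e)).

Definition hp_component (w : config hp_edge) (v : vertex) : set vertex :=
  [set u | clos_refl_trans vertex (hp_adjacent w) v u].

Definition is_hp_cluster (w : config hp_edge) (C : set vertex) : Prop :=
  exists2 v, half_plane v & C = hp_component w v.

Definition has_infinite_hp_cluster (w : config hp_edge) : Prop :=
  exists2 C, is_hp_cluster w C & infinite_set C.

(* Main.v *)
From HB Require Import structures.
Require Import Defs.
From mathcomp Require Import all_boot all_order all_algebra.
From mathcomp Require Import all_classical all_reals all_analysis.
From mathcomp Require Import zify.

(** Why the theorem is true.  In an odd subgraph of the square lattice every
    vertex has one or three open edges, so of the two colours, open and
    closed, one has a single edge there: an open path and a closed path never
    cross at a vertex.  (In an even subgraph two straight paths can cross.)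
    In a half-plane, where one cannot escape below, this makes the infinite
    open clusters and the infinite closed clusters incompatible.

    Let H_k be the half-plane of rows at least k.  Call column i rooted when
    the edge below (i, k) is open and (i, k) lies in an infinite open cluster
    of H_k.  Rooting is what makes non-crossing valid at the boundary: a
    closed path can slip below (i, k) only if the edge below (i, k) is closed
    (noncrossing).

    (1) Stationarity: if some column is rooted then rooted columns exist
    arbitrarily far to the left and to the right, for otherwise the last one
    would be uniformly distributed on the integers (stationary_unbounded).

    (2) Colour symmetry: the event that infinitely many columns are rooted is
    unchanged by finite even modifications.  The Haar measure cannot tell the
    even subgraph of all edges from a large finite one on any finite window,
    so such an event is almost surely unchanged by complementation
    (ae_tail_compl).  Hence if row k meets an infinite open cluster of H_k,
    almost surely there are columns rooted in the open colour and columns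
    rooted in the closed colour arbitrarily far on both sides (ae_regular).

    (3) By non-crossing each infinite cluster of H_k then has a finite trace on
    row k (trace_bounded), and there is more than one of them.

    (4) Mass transport: each infinite cluster of H_k meeting row k contains an
    infinite cluster of H_(k+1) meeting row k+1.  Both kinds of clusters have
    the same density, by vertical translation invariance, so almost surely
    each contains exactly one (ae_unique_child).

    (5) Finite energy: opening the edges of row k between two distinct infinite
    clusters, by a finite even modification that leaves H_(k+1) alone, merges
    them and produces a cluster with two descendants (two_children).  This
    contradicts (4), so no infinite cluster of H_k meets row k
    (ae_no_infinite_cluster).  An infinite cluster of the upper half-plane has
    a lowest row k, and is then an infinite cluster of H_k meeting row k. *)

Set Implicit Arguments.
Unset Strict Implicit.
Unset Printing Implicit Defensive.

Import Order.TTheory GRing.Theory Num.Theory.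

Local Open Scope classical_set_scope.
Local Open Scope ring_scope.

(** * Connections in a half-plane *)

Definition step (w : config edge) (u v : vertex) : bool :=
  [|| [&& v.1 == u.1 + 1, v.2 == u.2 & w (u, false)],
      [&& v.1 == u.1, v.2 == u.2 + 1 & w (u, true)],
      [&& u.1 == v.1 + 1, u.2 == v.2 & w (v, false)] |
      [&& u.1 == v.1, u.2 == v.2 + 1 & w (v, true)]].

Definition adj (w : config edge) (k : int) (u v : vertex) : bool :=
  [&& k <= u.2, k <= v.2 & step w u v].

Definition conn (w : config edge) (k : int) (u v : vertex) : Prop :=
  exists2 p, path (adj w k) u p & last u p = v.

(** Quantifying over finite lists, which are countable in number, makes this
    visibly a countable combination of connection events. *)
Definition infinite_cluster (w : config edge) (k : int) (u : vertex) : Prop :=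
  forall s : seq vertex, exists2 v, v \notin s & conn w k u v.

Lemma adj_sym w k u v : adj w k u v = adj w k v u.
Proof.
rewrite /adj /step andbCA; congr (_ && (_ && _)).
by do 4![case: [&& _, _ & _]].
Qed.

Lemma stepP (w : config edge) (u v : vertex) : step w u v ->
  [\/ v = (u.1 + 1, u.2) /\ w (u, false), v = (u.1, u.2 + 1) /\ w (u, true),
      u = (v.1 + 1, v.2) /\ w (v, false) | u = (v.1, v.2 + 1) /\ w (v, true)].
Proof.
case: u v => a b [c d]; rewrite /step /=.
case/or4P => /and3P[/eqP -> /eqP -> ?]; by [apply: Or41|apply: Or42|
  apply: Or43|apply: Or44].
Qed.

Lemma target_horizontal (a b : int) : target ((a, b), false) = (a + 1, b).
Proof. by rewrite /target /generator /=; congr pair; rewrite ?addr0. Qed.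

Lemma target_vertical (a b : int) : target ((a, b), true) = (a, b + 1).
Proof. by rewrite /target /generator /=; congr pair; rewrite ?addr0. Qed.

Lemma adjP (w : config edge) k x y : adj w k x y <->
  exists e : edge, [/\ k <= e.1.2, w e &
    (x = source e /\ y = target e) \/ (x = target e /\ y = source e)].
Proof.
split=> [/and3P[kx ky /stepP sxy]|[[[a b] d] [ka wa]]].
  case: x y kx ky sxy => a b [c d] /= kx ky [] [E we].
  - by exists ((a, b), false); split=> //; left; rewrite target_horizontal.
  - by exists ((a, b), true); split=> //; left; rewrite target_vertical.
  - by exists ((c, d), false); split=> //; right; rewrite target_horizontal.
  - by exists ((c, d), true); split=> //; right; rewrite target_vertical.
rewrite /= in ka; wlog: x y / x = source ((a, b), d) /\ y = target ((a, b), d).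
  move=> wl [h|[h1 h2]]; first by apply: wl; [|left].
  by rewrite adj_sym; apply: wl; [|left].
move=> [-> ->] _; case: d wa => wa.
  rewrite target_vertical /adj /step /source /= wa !eqxx /= orbT ka andbT; lia.
by rewrite target_horizontal /adj /step /source /= wa !eqxx /= ka.
Qed.

Lemma conn_refl w k u : conn w k u u.
Proof. by exists [::]. Qed.

Lemma conn_trans w k v u x : conn w k u v -> conn w k v x -> conn w k u x.
Proof.
move=> [p up <-] [q vq <-]; exists (p ++ q); last by rewrite last_cat.
by rewrite cat_path up.
Qed.

Lemma conn_adj w k u v : adj w k u v -> conn w k u v.
Proof. by move=> uv; exists [:: v] => //=; rewrite uv. Qed.

Lemma conn_ind w k u (P : vertex -> Prop) : P u ->
  (forall x y, conn w k u x -> P x -> adj w k x y -> P y) ->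
  forall v, conn w k u v -> P v.
Proof.
move=> Pu PS v [p]; elim/last_ind: p v => [v _ <- //|p y IH v].
rewrite rcons_path last_rcons => /andP[up xy] <-.
by apply: (PS _ y _ (IH _ up erefl) xy); exists p.
Qed.

Lemma conn_sym w k u v : conn w k u v -> conn w k v u.
Proof.
move: v; apply: conn_ind; first exact: conn_refl.
move=> x y _ xu xy; apply: conn_trans xu.
by apply: conn_adj; rewrite adj_sym.
Qed.

(** The comparison of adjacencies is only required along the cluster of u,
    which is how clusters avoiding a modified region are handled. *)
Lemma conn_sub w w' k k' u v :
  (forall x y, conn w k u x -> conn w' k' u x ->
     adj w k x y -> adj w' k' x y) ->
  conn w k u v -> conn w' k' u v.
Proof.
move=> sub uv.
suff: conn w k u v /\ conn w' k' u v by case.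
move: v uv; apply: conn_ind; first by split; exact: conn_refl.
move=> x y _ [ux ux'] xy; split.
  by apply: conn_trans ux _; exact: conn_adj.
by apply: conn_trans (ux') _; apply: conn_adj; exact: sub.
Qed.

Lemma infinite_cluster_conn w k u v :
  conn w k u v -> infinite_cluster w k u -> infinite_cluster w k v.
Proof.
move=> uv iu s; have [x xs ux] := iu s; exists x => //.
by apply: conn_trans ux; exact: conn_sym.
Qed.

Lemma infinite_cluster_sub w w' k k' u :
  (forall v, conn w k u v -> conn w' k' u v) ->
  infinite_cluster w k u -> infinite_cluster w' k' u.
Proof.
by move=> sub iu s; have [x xs ux] := iu s; exists x => //; exact: sub.
Qed.

Lemma finite_clusterP w k u : ~ infinite_cluster w k u ->
  exists s : seq vertex, forall v, conn w k u v -> v \in s.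
Proof.
move=> fin; apply: contrapT => nofin; apply: fin => s.
apply: contrapT => no; apply: nofin; exists s => v uv.
by apply/negPn/negP => vs; apply: no; exists v.
Qed.

Lemma seq_bound (S T : eqType) (r : seq S) (P : S -> T -> Prop) :
  (forall x, x \in r -> exists s : seq T, forall y, P x y -> y \in s) ->
  exists s : seq T, forall x y, x \in r -> P x y -> y \in s.
Proof.
elim: r => [|x r IH] bd; first by exists [::].
have [|s hs] := IH; first by move=> z zr; apply: bd; rewrite inE zr orbT.
have [|t ht] := bd x; first by rewrite inE eqxx.
exists (t ++ s) => z y; rewrite inE mem_cat => /orP[/eqP ->|zr] Pzy.
  by rewrite ht.
by rewrite (hs z) ?orbT.
Qed.

Lemma adj_local w w' k x y : (forall e, k <= e.1.2 -> w e = w' e) ->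
  adj w k x y = adj w' k x y.
Proof.
move=> ww'; rewrite /adj /step.
case: (boolP (k <= x.2)) => //= kx; case: (boolP (k <= y.2)) => //= ky.
by rewrite !ww'.
Qed.

Lemma conn_local w w' k u v : (forall e, k <= e.1.2 -> w e = w' e) ->
  conn w k u v -> conn w' k u v.
Proof.
by move=> ww'; apply: conn_sub => x y _ _; rewrite (adj_local _ _ ww').
Qed.

Lemma infinite_cluster_local w w' k u : (forall e, k <= e.1.2 -> w e = w' e) ->
  infinite_cluster w k u -> infinite_cluster w' k u.
Proof. by move=> ww'; apply: infinite_cluster_sub => v; exact: conn_local. Qed.

Lemma adj_mono w k k' x y : k' <= k -> adj w k x y -> adj w k' x y.
Proof.
move=> kk' /and3P[kx ky sxy]; rewrite /adj sxy andbT.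
by rewrite (le_trans kk' kx) (le_trans kk' ky).
Qed.

Lemma conn_mono w k k' u v : k' <= k -> conn w k u v -> conn w k' u v.
Proof. by move=> kk'; apply: conn_sub => x y _ _; exact: adj_mono. Qed.

Lemma conn_row w k u v : k <= u.2 -> conn w k u v -> k <= v.2.
Proof.
by move=> ku; move: v; apply: conn_ind => // x y _ _ /and3P[].
Qed.

(** * Rooted columns *)

(** The edge joining (i, k) to the row below.  Although it is not an edge of
    H_k, it is determined there when all degrees are odd, and it decides
    whether paths of the other colour can pass below (i, k). *)
Definition dangling (w : config edge) (k i : int) : bool :=
  w ((i, k - 1), true).

Definition rooted (w : config edge) (k i : int) : Prop :=
  dangling w k i /\ infinite_cluster w k (i, k).

Definition compl (w : config edge) : config edge := fun e => ~~ w e.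

Definition infinitely_many (P : int -> Prop) : Prop :=
  forall s : seq int, exists2 i, i \notin s & P i.

Definition edge_ends (G : seq edge) : seq vertex :=
  [seq source e | e <- G] ++ [seq target e | e <- G].

Lemma adj_edge (w w' : config edge) k x y : adj w k x y ->
  (forall e, x = source e \/ x = target e -> w e -> w' e) -> adj w' k x y.
Proof.
move=> /adjP[e [ke we xy]] ww'; apply/adjP; exists e; split=> //.
by apply: ww' we; case: xy => -[? _]; [left|right].
Qed.

(** Only finitely many columns are lost: a column whose new cluster avoids the
    modified edges keeps its cluster, while the clusters through a given end
    of a modified edge are either finite, or infinite and then root every
    column they reach through an unmodified dangling edge. *)
Lemma rooted_finite_toggle (G : seq edge) (g w : config edge) (k : int) :
  (forall e, g e -> e \in G) ->
  infinitely_many (rooted w k) -> infinitely_many (rooted (symdiff g w) k).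
Proof.
move=> gG inf; set w' := symdiff g w; set V := edge_ends G.
have same e : source e \notin V \/ target e \notin V -> w' e = w e.
  move=> eV; rewrite /w' /symdiff; case ge: (g e) => //=.
  have eG := gG _ ge.
  by case: eV => /negP[]; rewrite mem_cat map_f ?orbT.
apply: contrapT => /existsNP[s] /forall2NP nos.
have {}nos i : rooted w' k i -> i \in s.
  by move=> li; case: (nos i) => // /negP; rewrite negbK.
have down i : (i, k) \notin V -> dangling w' k i = dangling w k i.
  move=> iV; apply: same; right; rewrite /target /generator /=.
  rewrite (_ : (i, k - 1) + (0, 1) = (i, k)) //.
  by congr pair; rewrite ?addr0 ?subrK.
(* S contains every column that is rooted in the new configuration through a
   cluster touching V, and every column of a finite such cluster. *)
have [S hS] : exists S : seq int, forall x i, x \in V ->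
    dangling w' k i /\ conn w' k (i, k) x -> i \in S.
  apply: seq_bound => x xV.
  have [ix|/finite_clusterP[t ht]] := pselect (infinite_cluster w' k x).
    exists s => i [di ci]; apply: nos; split => //.
    by apply: infinite_cluster_conn ix; exact: conn_sym.
  exists [seq z.1 | z <- t] => i [_ /conn_sym/ht xt].
  by apply/mapP; exists (i, k).
have [i] := inf (s ++ S ++ [seq z.1 | z <- V]).
rewrite !mem_cat !negb_or => /and3P[si Si Vi] [di ii].
have iV : (i, k) \notin V.
  by apply: contra Vi => iV; apply/mapP; exists (i, k).
have di' : dangling w' k i by rewrite down.
have avoid x : conn w' k (i, k) x -> x \notin V.
  by move=> cx; apply: contra Si => xV; apply: (hS x).
move/negP: si; apply; apply: nos; split => //.
apply: infinite_cluster_sub ii => v; apply: conn_sub => x y _ /avoid xV xy.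
apply: adj_edge xy _ => e xe; rewrite same //.
by case: xe => <-; [left|right].
Qed.

(** * Open and closed paths do not cross *)

Lemma degreeE (w : config edge) (a b : int) :
  degree w (a, b) =
  (w ((a, b), false) + w ((a, b), true) +
   w (((a - 1)%R, b), false) + w ((a, (b - 1)%R), true))%N.
Proof.
rewrite /degree /= /generator /= addn0 !addnA.
rewrite (_ : (a, b) - (1, 0) = (a - 1, b)); last by congr pair; rewrite ?subr0.
by rewrite (_ : (a, b) - (0, 1) = (a, b - 1)) //; congr pair; rewrite ?subr0.
Qed.

Definition crosses (a b : int) (u v : vertex) : bool :=
  [&& u.1 == v.1, a < u.1 &
      (u.2 == b) && (v.2 == b + 1) || (v.2 == b) && (u.2 == b + 1)].

(** Parity of the vertical steps that the path makes at height b, to the right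
    of the unit face with lower left corner (a, b): its winding number modulo
    2 around that face, once the path is closed up from below. *)
Fixpoint winding (u : vertex) (p : seq vertex) (a b : int) : bool :=
  if p is v :: p' then crosses a b u v (+) winding v p' a b else false.

Definition ray (a b : int) (u : vertex) : bool := (u.2 == b) && (a < u.1).

Lemma winding_vert (w : config edge) k u p (a b : int) :
  ~~ w ((a, b), true) -> path (adj w k) u p ->
  winding u p (a - 1) b = winding u p a b.
Proof.
move=> wN; elim: p u => //= v p IH u /andP[/and3P[_ _ /stepP uv] /IH ->].
congr (_ (+) _); rewrite /crosses; case: u v uv => [x y] [z t] /= [] [[-> ->] we].
- lia.
- rewrite eqxx /=; have [E|] := eqVneq (x, y) (a, b); first by rewrite -E we in wN.
  rewrite -pair_eqE /=; lia.
- lia.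
- rewrite eqxx /=; have [E|] := eqVneq (z, t) (a, b); first by rewrite -E we in wN.
  rewrite -pair_eqE /=; lia.
Qed.

(** Each step of the path changes the left-hand side exactly when it enters or
    leaves the ray to the right of (a, b): the horizontal step that would do so
    without being counted crosses the edge at (a, b), which is closed. *)
Lemma winding_horiz (w : config edge) k u p (a b : int) :
  ~~ w ((a, b), false) -> path (adj w k) u p ->
  winding u p a b (+) winding u p a (b - 1) = ray a b u (+) ray a b (last u p).
Proof.
move=> wN; elim: p u => [u _|v p IH u /=]; first by rewrite /= addbb.
move=> /andP[/and3P[_ _ /stepP uv] /IH {}IH].
rewrite addbACA {}IH [RHS](_ : _ = (ray a b u (+) ray a b v) (+)
  (ray a b v (+) ray a b (last v p))); last by rewrite addbA addbK.
congr (_ (+) _); rewrite /crosses /ray subrK.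
case: u v uv => [x y] [z t] /= [] [[-> ->] we].
- have [E|] := eqVneq (x, y) (a, b); first by rewrite -E we in wN.
  rewrite -pair_eqE /=; lia.
- lia.
- have [E|] := eqVneq (z, t) (a, b); first by rewrite -E we in wN.
  rewrite -pair_eqE /=; lia.
- lia.
Qed.

Lemma winding_below (w : config edge) k u p (a b : int) :
  b < k -> path (adj w k) u p -> winding u p a b = false.
Proof.
move=> bk; elim: p u => //= v p IH u /andP[/and3P[ku kv _] /IH ->].
rewrite /crosses; lia.
Qed.

(** When the whole path lies to the right of the face, the steps counted are
    all the crossings of a horizontal line. *)
Lemma winding_left (w : config edge) k u p (a b : int) :
  path (adj w k) u p -> (forall v, v \in u :: p -> a < v.1) ->
  winding u p a b = (u.2 <= b) (+) ((last u p).2 <= b).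
Proof.
elim: p u => [u _ _|v p IH u /=]; first by rewrite /= addbb.
move=> /andP[/and3P[_ _ /stepP uv] /IH {}IH] ap.
rewrite {}IH; last by move=> x xp; apply: ap; rewrite inE xp orbT.
rewrite addbA; congr (_ (+) _).
have au : a < u.1 by apply: ap; rewrite inE eqxx.
by rewrite /crosses; case: u v uv au {ap} => [x y] [z t] /= [] [[-> ->] we]; lia.
Qed.

Lemma winding_notin u p (a b : int) :
  (forall v, v \in u :: p -> v.1 <= a \/ v.2 < b) -> winding u p a b = false.
Proof.
elim: p u => //= v p IH u ap; rewrite IH; last first.
  by move=> x xp; apply: ap; rewrite inE xp orbT.
have := ap u; have := ap v; rewrite /crosses !inE !eqxx orbT.
case: u v {ap IH} => [x y] [z t] /= /(_ isT) uv /(_ isT) uu; lia.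
Qed.

Lemma seq_vertex_bounded (p : seq vertex) : exists2 N : int,
  0 <= N & forall v, v \in p -> [/\ - N <= v.1, v.1 <= N & v.2 <= N].
Proof.
elim: p => [|[a b] p [N N0 IH]]; first by exists 0.
exists (N + `|a| + `|b|) => [|[c d]]; first lia.
by rewrite inE => /orP[/eqP[-> ->]|/IH [/= ? ? ?]]; split=> /=; lia.
Qed.

Lemma bounded_finite (N : int) : exists s : seq vertex, forall v : vertex,
  [/\ - N <= v.1, v.1 <= N, - N <= v.2 & v.2 <= N] -> v \in s.
Proof.
pose r : seq int := [seq i%:Z - N | i <- iota 0 (absz N + absz N).+1].
have mr (x : int) : - N <= x -> x <= N -> x \in r.
  move=> x1 x2; apply/mapP; exists (absz (x + N)); last lia.
  rewrite mem_iota; lia.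
exists [seq (x, y) | x <- r, y <- r] => -[x y] [? ? ? ?].
by apply: allpairs_f; apply: mr.
Qed.

(** The heart of the matter.  Read r, u, l, d as the states of the four edges
    at a vertex and ne, nw, sw, se as the sides of a contour, made of open
    edges, on which the four faces lie.  If two edges at the vertex are closed
    then three are, by parity, and they glue all four faces together: a path
    going through closed edges stays on one side of the contour. *)
Lemma sides_agree (r u l d ne nw sw se : bool) : odd (r + u + l + d) ->
  (~~ r -> ne = se) -> (~~ l -> nw = sw) ->
  (~~ u -> nw = ne) -> (~~ d -> sw = se) ->
  [|| [&& ~~ r, ne & se], [&& ~~ u, ne & nw],
      [&& ~~ l, nw & sw] | [&& ~~ d, se & sw]] ->
  [/\ ~~ r -> ne && se, ~~ u -> ne && nw, ~~ l -> nw && sw & ~~ d -> se && sw].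
Proof.
move=> o hr hl hu hd.
have {}hr : r || (ne == se) by case: r {o} hr => //= ->.
have {}hl : l || (nw == sw) by case: l {o} hl => //= ->.
have {}hu : u || (nw == ne) by case: u {o} hu => //= ->.
have {}hd : d || (sw == se) by case: d {o} hd => //= ->.
move: o hr hl hu hd.
case: r => /=; case: u => /=; case: l => /=; case: d => //= _;
 by case: ne; case: nw; case: sw; case: se.
Qed.

(** The open path from (i, k) to (m, k), closed up below row k, is a contour
    around the closed dangling edge of column j.  By sides_agree an infinite
    closed path from (j, k) leaves the inside of that contour only below one
    of its two ends, and only if the dangling edge there is closed. *)
Lemma noncrossing (w : config edge) (k i j m : int) :
  odd_subgraph w -> conn w k (i, k) (m, k) -> i < j -> j < m ->
  ~~ dangling w k j -> infinite_cluster (compl w) k (j, k) ->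
  (~~ dangling w k i /\ conn (compl w) k (j, k) (i, k)) \/
  (~~ dangling w k m /\ conn (compl w) k (j, k) (m, k)).
Proof.
move=> wodd [p pw plast] ij jm dj infj; apply: contrapT => /not_orP[noi nom].
(* F marks the faces inside the contour; below row k the contour consists of
   the two vertical lines going down from (i, k) and (m, k). *)
pose F (a b : int) : bool := if k <= b then winding (i, k) p a b
  else (b == k - 1) && ((a < i) (+) (a < m)).
have Fh (a b : int) : k <= b -> ~~ w ((a, b), false) -> F a b = F a (b - 1).
  move=> kb wN; have := winding_horiz wN pw; rewrite plast /ray /F kb.
  case: ifPn => kb1.
    rewrite /=; rewrite (_ : (k == b) = false) /=; last lia.
    by case: (winding _ _ _ _); case: (winding _ _ _ _).
  rewrite (winding_below (b := b - 1) a _ pw); last lia.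
  have -> : b = k by lia.
  by rewrite /= !eqxx addbF.
have Fv (a b : int) : k - 1 <= b -> ~~ w ((a, b), true) ->
    (b = k - 1 -> a <> i /\ a <> m) -> F (a - 1) b = F a b.
  move=> kb wN ex; rewrite /F; case: ifPn => kb1.
    exact: winding_vert wN pw.
  by have [? ?] := ex ltac:(lia); lia.
(* Some closed edge at v has both its faces inside the contour. *)
pose Inv (v : vertex) := let: (a, b) := v in
  [|| [&& ~~ w ((a, b), false), F a b & F a (b - 1)],
      [&& ~~ w ((a, b), true), F a b & F (a - 1) b],
      [&& ~~ w ((a - 1, b), false), F (a - 1) b & F (a - 1) (b - 1)] |
      [&& ~~ w ((a, b - 1), true), F a (b - 1) & F (a - 1) (b - 1)]].
have local (a b : int) : k <= b -> conn (compl w) k (j, k) (a, b) ->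
    Inv (a, b) ->
    [/\ ~~ w ((a, b), false) -> F a b && F a (b - 1),
        ~~ w ((a, b), true) -> F a b && F (a - 1) b,
        ~~ w ((a - 1, b), false) -> F (a - 1) b && F (a - 1) (b - 1) &
        ~~ w ((a, b - 1), true) -> F a (b - 1) && F (a - 1) (b - 1)].
  move=> kb jab; have := wodd (a, b); rewrite degreeE /Inv.
  have hR := @Fh a b kb; have hL := @Fh (a - 1) b kb.
  have hU : ~~ w ((a, b), true) -> F (a - 1) b = F a b.
    move=> wN; apply: Fv => //; clear -kb; lia.
  have hD : ~~ w ((a, b - 1), true) -> F (a - 1) (b - 1) = F a (b - 1).
    move=> wN; apply: Fv => //; first by clear -kb; lia.
    move=> bk; have {}bk : b = k by clear -bk; lia.
    by subst b; split=> E; subst a; [apply: noi|apply: nom].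
  by move=> o; exact: sides_agree.
have inv v : conn (compl w) k (j, k) v -> Inv v.
  move: v; apply: conn_ind.
    rewrite /Inv; apply/or4P; apply: Or44; apply/and3P; split => //;
      rewrite /F (_ : (k <= k - 1) = false) ?eqxx /=; lia.
  move=> [a b] [c d] jab /local {}local /and3P[kb kd sab].
  have [lR lU lL lD] := local kb jab.
  case: (stepP sab) => /= -[[E1 E2] we]; rewrite /compl in we.
  - subst c d; have /andP[h1 h2] := lR we; apply/or4P; apply: Or43.
    by rewrite addrK we h1 h2.
  - subst c d; have /andP[h1 h2] := lU we; apply/or4P; apply: Or44.
    by rewrite addrK we h1 h2.
  - subst a b; rewrite !addrK in lL; have /andP[h1 h2] := lL we.
    by apply/or4P; apply: Or41; rewrite we h1 h2.
  - subst a b; rewrite !addrK in lD; have /andP[h1 h2] := lD we.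
    by apply/or4P; apply: Or42; rewrite we h1 h2.
(* The inside is bounded, so the closed cluster of (j, k) would be finite. *)
have [N N0 pN] := seq_vertex_bounded ((i, k) :: p).
have Fbd (a b : int) : F a b -> [/\ - N - 1 <= a, a <= N, k - 1 <= b & b <= N].
  have [|/= i1 i2 k1] := pN (i, k); first by rewrite inE eqxx.
  have [|/= m1 m2 _] := pN (m, k); first by rewrite -plast mem_last.
  rewrite /F; case: ifPn => kb; last by move=> h; clear -h kb i1 i2 k1 m1 m2; split; lia.
  move=> wab; have [aN|aN] := leP a (- N - 1).
    move: wab; rewrite (winding_left b pw) ?plast /= ?addbb //.
    by move=> [x y] /pN[/= xN _ _]; clear -aN xN; lia.
  have [aN'|aN'] := leP N a.
    move: wab; rewrite winding_notin // => -[x y] /pN[/= _ xN _]; left.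
    by clear -xN aN'; lia.
  have [bN|bN] := ltP N b.
    move: wab; rewrite winding_notin // => -[x y] /pN[/= _ _ yN]; right.
    by clear -yN bN; lia.
  by clear -kb aN aN' bN; split; lia.
have [s hs] := bounded_finite (N + 2 + `|k|).
have [[a b] /negP nin /inv iv] := infj s; apply: nin; apply: hs => /=.
move: iv.
by case/or4P => /and3P[_ /Fbd[h1 h2 h3 h4] /Fbd[h5 h6 h7 h8]];
  clear -h1 h2 h3 h4 h5 h6 h7 h8; split; lia.
Qed.

Lemma complK : involutive compl.
Proof. by move=> w; apply/funext => e; rewrite /compl negbK. Qed.

Lemma odd_compl w : odd_subgraph w -> odd_subgraph (compl w).
Proof.
move=> ow [a b]; have := ow (a, b); rewrite !degreeE /compl.
by do 4![case: (w _)].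
Qed.

Definition two_sided (P : int -> Prop) : Prop :=
  forall n, (exists2 i, i < n & P i) /\ (exists2 i, n < i & P i).

(** Both dangling edges being closed, there is no way out below the ends. *)
Lemma linked_compl_rooted w k a b c : odd_subgraph w ->
  conn (compl w) k (a, k) (b, k) -> a < c -> c < b ->
  rooted (compl w) k a -> rooted (compl w) k b -> rooted w k c -> False.
Proof.
move=> ow ab ac cb [da _] [db _] [dc ic].
have [||[na _]|[nb _]] := noncrossing (odd_compl ow) ab ac cb.
- by rewrite /dangling /compl negbK.
- by rewrite complK.
- by rewrite da in na.
- by rewrite db in nb.
Qed.

Lemma linked_rooted w k a b c : odd_subgraph w ->
  conn w k (a, k) (b, k) -> a < c -> c < b ->
  rooted w k a -> rooted w k b -> rooted (compl w) k c -> False.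
Proof.
move=> ow; have := @linked_compl_rooted (compl w) k a b c (odd_compl ow).
by rewrite complK.
Qed.

(** Each of the three closed clusters can escape the open path from a to b only
    below a or below b, so two of them share their exit, hence are linked;
    but a column rooted in the open colour lies between them. *)
Lemma no_wide_link w k a b c1 o1 c2 o2 c3 : odd_subgraph w ->
  conn w k (a, k) (b, k) ->
  a < c1 -> c1 < o1 -> o1 < c2 -> c2 < o2 -> o2 < c3 -> c3 < b ->
  rooted (compl w) k c1 -> rooted w k o1 -> rooted (compl w) k c2 ->
  rooted w k o2 -> rooted (compl w) k c3 -> False.
Proof.
move=> ow ab ac1 co1 oc2 co2 oc3 cb l1 m1 l2 m2 l3.
have exit c : a < c -> c < b -> rooted (compl w) k c ->
    conn (compl w) k (c, k) (a, k) \/ conn (compl w) k (c, k) (b, k).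
  move=> ac c_b [dc ic].
  by have [//|[_ ?]|[_ ?]] := noncrossing ow ab ac c_b _ ic; [left|right].
have co3 : o1 < c3 by lia.
have link c c' x : conn (compl w) k (c, k) x -> conn (compl w) k (c', k) x ->
    conn (compl w) k (c, k) (c', k).
  by move=> cx /conn_sym; exact: conn_trans.
have k12 x : conn (compl w) k (c1, k) x -> conn (compl w) k (c2, k) x -> False.
  by move=> h /(link _ _ _ h) h'; exact: linked_compl_rooted ow h' co1 oc2 l1 l2 m1.
have k13 x : conn (compl w) k (c1, k) x -> conn (compl w) k (c3, k) x -> False.
  by move=> h /(link _ _ _ h) h'; exact: linked_compl_rooted ow h' co1 co3 l1 l3 m1.
have k23 x : conn (compl w) k (c2, k) x -> conn (compl w) k (c3, k) x -> False.
  by move=> h /(link _ _ _ h) h'; exact: linked_compl_rooted ow h' co2 oc3 l2 l3 m2.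
have b1 : c1 < b by clear -oc2 co1 co2 oc3 cb; lia.
have b2 : c2 < b by clear -co2 oc3 cb; lia.
have a2 : a < c2 by clear -ac1 co1 oc2; lia.
have a3 : a < c3 by clear -a2 co2 oc3; lia.
have [h1|h1] := exit c1 ac1 b1 l1; have [h2|h2] := exit c2 a2 b2 l2;
  have [h3|h3] := exit c3 a3 cb l3;
  by [exact: k12 h1 h2|exact: k13 h1 h3|exact: k23 h2 h3].
Qed.

(** The almost sure picture on row k, from which all later contradictions are
    drawn deterministically. *)
Definition regular (w : config edge) (k : int) : Prop :=
  odd_subgraph w /\
  ((exists i, infinite_cluster w k (i, k)) ->
   two_sided (rooted w k) /\ two_sided (rooted (compl w) k)).

Lemma trace_bounded w k i : regular w k -> infinite_cluster w k (i, k) ->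
  exists L U : int, forall m, conn w k (i, k) (m, k) -> L <= m /\ m <= U.
Proof.
move=> [ow gw] ii; have [|tl tc] := gw; first by exists i.
have [[c1 c1i l1] [d1 id1 e1]] := tc i.
have [[q1 oc1 m1] _] := tl c1; have [_ [p1 dp1 f1]] := tl d1.
have [[c2 co1 l2] _] := tc q1; have [_ [d2 pd1 e2]] := tc p1.
have [[q2 oc2 m2] _] := tl c2; have [_ [p2 dp2 f2]] := tl d2.
have [[c3 co2 l3] _] := tc q2; have [_ [d3 pd2 e3]] := tc p2.
exists c3, d3 => m im; split; rewrite leNgt; apply/negP => hm.
  exact: no_wide_link ow (conn_sym im) hm co2 oc2 co1 oc1 c1i l3 m2 l2 m1 l1.
exact: no_wide_link ow im id1 dp1 pd1 dp2 pd2 hm e1 f1 e2 f2 e3.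
Qed.

Lemma int_range (L U : int) : exists s : seq int, forall m, L <= m -> m <= U -> m \in s.
Proof.
exists [seq L + i%:Z | i <- iota 0 (absz (U - L)).+1] => m Lm mU.
apply/mapP; exists (absz (m - L)); last lia.
rewrite mem_iota; lia.
Qed.

(** Cut every path from (i, k) at its last visit to row k: all but finitely many
    vertices of the cluster belong to one of the finitely many clusters of
    H_(k+1) that start right above the trace of the cluster on row k. *)
Lemma infinite_upper_cluster w k i L U : infinite_cluster w k (i, k) ->
  (forall m, conn w k (i, k) (m, k) -> L <= m /\ m <= U) ->
  exists2 j, infinite_cluster w (k + 1) (j, k + 1) &
             conn w k (i, k) (j, k + 1).
Proof.
move=> ii bd; apply: contrapT => noj.
have [r hr] := int_range L U.
have [S hS] : exists S : seq vertex, forall j v, j \in r ->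
    conn w k (i, k) (j, k + 1) /\ conn w (k + 1) (j, k + 1) v -> v \in S.
  apply: seq_bound => j _.
  have [cj|ncj] := pselect (conn w k (i, k) (j, k + 1)); last by exists [::] => y [].
  have [|s hs] := @finite_clusterP w (k + 1) (j, k + 1); last by exists s => y [_ /hs].
  by move=> ij; apply: noj; exists j.
suff cl v : conn w k (i, k) v -> v \in [seq (j, k) | j <- r] ++ S.
  by have [v /negP nv /cl] := ii ([seq (j, k) | j <- r] ++ S).
move=> iv; suff [vk|[j jr [cj jv]]] : v.2 = k \/ exists2 j, j \in r &
    conn w k (i, k) (j, k + 1) /\ conn w (k + 1) (j, k + 1) v.
- rewrite mem_cat; apply/orP; left; apply/mapP; exists v.1.
    by case: v vk iv => a b /= -> /bd[? ?]; exact: hr.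
  by case: v vk {iv} => a b /= ->.
- by rewrite mem_cat (hS j) ?orbT.
move: v iv; apply: conn_ind; first by left.
move=> [a b] [c d] ix IH xy; have := xy => /and3P[/= kb kd sab].
have [dk|dk] := eqVneq d k; first by left.
right; case: IH => [/= bk|[j jr [ij jx]]]; last first.
  exists j => //; split=> //; apply: conn_trans (jx) _.
  apply: conn_adj; rewrite /adj /= sab andbT.
  have /= := conn_row _ jx; lia.
have [? ?] : c = a /\ d = k + 1.
  by case: (stepP sab) => /= -[] [? ?] _; lia.
subst b c d; have [? ?] := bd _ ix.
exists a; first exact: hr.
split; last exact: conn_refl.
by apply: conn_trans ix _; exact: conn_adj.
Qed.

Definition leftmost (w : config edge) (k i : int) : Prop :=
  infinite_cluster w k (i, k) /\
  forall i', i' < i -> ~ conn w k (i, k) (i', k).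

Lemma exists_leftmost w k i L : infinite_cluster w k (i, k) ->
  (forall m, conn w k (i, k) (m, k) -> L <= m) ->
  exists2 j, leftmost w k j & conn w k (i, k) (j, k).
Proof.
move=> ii bd.
have exn : exists n : nat, `[< conn w k (i, k) (L + n%:Z, k) >].
  exists (absz (i - L)); apply/asboolP.
  rewrite (_ : L + _ = i); first exact: conn_refl.
  have := bd i (conn_refl _ _ _); lia.
have [n /asboolP cn minn] := ex_minnP exn.
exists (L + n%:Z) => //; split; first exact: infinite_cluster_conn ii.
move=> i' ltn ci'.
have ci : conn w k (i, k) (i', k) by exact: conn_trans ci'.
have Li := bd _ ci.
have := minn (absz (i' - L)).
rewrite (_ : L + _ = i'); last lia.
by move=> /(_ (asboolT ci)); lia.
Qed.

(** Leftmost vertices serve as labels of clusters: the cluster of H_(k+1)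
    labelled j is contained in the cluster of H_k labelled i. *)
Definition child (w : config edge) (k i j : int) : Prop :=
  [/\ leftmost w k i, leftmost w (k + 1) j & conn w k (i, k) (j, k + 1)].

Lemma exists_child w k i : regular w k -> regular w (k + 1) -> leftmost w k i ->
  exists j, child w k i j.
Proof.
move=> gk gk1 li; have [ii _] := li.
have [L [U bd]] := trace_bounded gk ii.
have [j ij cj] := infinite_upper_cluster ii bd.
have [L1 [U1 bd1]] := trace_bounded gk1 ij.
have [|j1 lj1 cj1] := exists_leftmost (L := L1) ij.
  by move=> m /bd1[].
exists j1; split=> //; apply: conn_trans cj _.
by apply: conn_mono cj1; lia.
Qed.

(** * Finite even modifications *)

(** The sum modulo 2 of the boundaries of the unit faces selected by f, a face
    being named by its lower left corner. *)
Definition boundary (f : pred vertex) : config edge := fun e =>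
  let: ((a, b), d) := e in
  f (a, b) (+) (if d then f (a - 1, b) else f (a, b - 1)).

Lemma even_boundary f : even_subgraph (boundary f).
Proof.
move=> [a b]; rewrite degreeE /boundary.
by do 4![case: (f _)].
Qed.

Definition faces (s : seq vertex) : config edge := boundary (mem s).

Lemma faces_finite s : exists G : seq edge, forall e, faces s e -> e \in G.
Proof.
exists (flatten [seq [:: ((p.1, p.2), false); ((p.1, p.2 + 1), false);
  ((p.1, p.2), true); ((p.1 + 1, p.2), true)] | p <- s]) => -[[a b] d] /= H.
have {H} : ((a, b) \in s) || ((if d then (a - 1, b) else (a, b - 1)) \in s).
  by case: d H; case: (_ \in s); case: (_ \in s).
case/orP => ps; apply/flatten_mapP; eexists; try exact: ps.
  by case: d {ps}; rewrite !inE /= !eqxx ?orbT.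
by case: d {ps} => /=; rewrite !inE /= subrK !eqxx ?orbT.
Qed.

Lemma faces_above k s e : (forall p, p \in s -> p.2 = k - 1) -> k <= e.1.2 ->
  faces s e = [&& ~~ e.2, e.1.2 == k & (e.1.1, k - 1) \in s].
Proof.
case: e => -[a b] d /= hs kb.
have nab x : (x, b) \in s = false by apply/negP => /hs /=; lia.
rewrite !nab; case: d => //=.
have [->//|bk] := eqVneq b k.
apply/negP => /hs /=; lia.
Qed.

Lemma dangling_faces1 w k i j :
  dangling (symdiff (faces [:: (i, k - 1)]) w) k j =
  (j == i) (+) (j - 1 == i) (+) dangling w k j.
Proof.
rewrite /dangling /symdiff /faces /boundary /= !inE -!pair_eqE /= !eqxx !andbT.
by [].
Qed.

(** Toggling the face below the edge from (i, k) to (i+1, k) opens both closed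
    dangling edges and changes a single edge of H_k.  If this cuts the
    infinite cluster, one of the two ends still has an infinite one. *)
Lemma rooted_or_toggle w k i : infinite_cluster w k (i, k) -> exists i',
  rooted w k i' \/ rooted (symdiff (faces [:: (i, k - 1)]) w) k i'.
Proof.
move=> ii; set w' := symdiff _ _.
have dw' := dangling_faces1 w k i; rewrite -/w' in dw'.
have [di|di] := boolP (dangling w k i); first by exists i; left.
have w'E e : k <= e.1.2 -> e != ((i, k), false) -> w' e = w e.
  move=> ke ne; rewrite /w' /symdiff (@faces_above k) //; last first.
    by move=> p; rewrite inE => /eqP ->.
  case: [&& _, _ & _] / and3P => // -[d bk].
  rewrite inE -pair_eqE => /andP[/= /eqP ai _]; move: ne.
  by case: e {ke} d bk ai => -[a b] [] //= _ /eqP -> ->; rewrite eqxx.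
have [r|r] := boolP (w ((i, k), false)); last first.
  exists i; right; split; first by rewrite dw' eqxx (negPf di); lia.
  apply: infinite_cluster_sub ii => v; apply: conn_sub => x y _ _ /adjP[e [ke we xy]].
  apply/adjP; exists e; split=> //; rewrite w'E //.
  by apply: contraNneq r => <-.
have ii1 : infinite_cluster w k (i + 1, k).
  apply: infinite_cluster_conn ii; apply: conn_adj; apply/adjP.
  by exists ((i, k), false); split=> //; left; split=> //; rewrite target_horizontal.
have [di1|di1] := boolP (dangling w k (i + 1)); first by exists (i + 1); left.
have [i0|fin0] := pselect (infinite_cluster w' k (i, k)).
  by exists i; right; split=> //; rewrite dw' eqxx (negPf di); lia.
have [i1|fin1] := pselect (infinite_cluster w' k (i + 1, k)).
  by exists (i + 1); right; split=> //; rewrite dw' addrK eqxx (negPf di1); lia.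
have [[s0 h0] [s1 h1]] := (finite_clusterP fin0, finite_clusterP fin1).
have [v] := ii (s0 ++ s1); rewrite mem_cat => /norP[/negP n0 /negP n1] iv.
suff [/h0//|/h1//] : conn w' k (i, k) v \/ conn w' k (i + 1, k) v.
move: v iv {n0 n1}; apply: conn_ind; first by left; exact: conn_refl.
move=> x y _ IH /adjP[e [ke we xy]].
have [ee|ne] := eqVneq e ((i, k), false).
  case: xy => -[_ ->]; rewrite ee; last by left; exact: conn_refl.
  by right; rewrite target_horizontal; exact: conn_refl.
have xy' : conn w' k x y.
  by apply: conn_adj; apply/adjP; exists e; split=> //; rewrite w'E.
by case: IH => h; [left|right]; exact: conn_trans xy'.
Qed.

(** Toggling the faces just below the closed edges of row k between i and i'
    opens these edges and changes nothing else in H_k. *)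
Lemma merge_clusters w k i i' : i <= i' -> exists s : seq vertex,
  let w' := symdiff (faces s) w in
  [/\ forall e, k + 1 <= e.1.2 -> w' e = w e,
      forall e, k <= e.1.2 -> w e -> w' e &
      conn w' k (i, k) (i', k)].
Proof.
move=> ii'; pose a n : int := i + n%:Z.
pose s : seq vertex := [seq (a n, k - 1) |
  n <- [seq n <- iota 0 (absz (i' - i)) | ~~ w ((a n, k), false)]].
have hs p : p \in s -> p.2 = k - 1 by move=> /mapP[n _ ->].
exists s => w'; split.
- move=> e ke; rewrite /w' /symdiff (@faces_above k) //; last lia.
  by case: eqP => // ek; rewrite ?andbF //; lia.
- move=> e ke we; rewrite /w' /symdiff we (@faces_above k) //.
  case: and3P => // -[/negPf d /eqP bk /mapP[n]].
  rewrite mem_filter => /andP[+ _] [an].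
  by case: e {ke} d bk an we => -[x y] [] //= _ -> -> ->.
have row n : (n <= absz (i' - i))%N -> conn w' k (i, k) (a n, k).
  elim: n => [_|n IH nlt]; first by rewrite /a addr0; exact: conn_refl.
  apply: conn_trans (IH (ltnW nlt)) _; apply: conn_adj; apply/adjP.
  exists ((a n, k), false); split=> //; last first.
    by left; split => //; rewrite target_horizontal /a; congr pair; lia.
  rewrite /w' /symdiff (@faces_above k) //= eqxx /=.
  case: (boolP (w _)) => wn; rewrite ?addbF ?addbT.
    apply/negP => /mapP[m]; rewrite mem_filter => /andP[wm _] [/addrI[nm]].
    by rewrite -nm wn in wm.
  by apply: map_f; rewrite mem_filter wn mem_iota; lia.
by have := row _ (leqnn _); rewrite (_ : a _ = i') // /a; lia.
Qed.

Lemma leftmost_local w w' k j : (forall e, k <= e.1.2 -> w e = w' e) ->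
  leftmost w k j -> leftmost w' k j.
Proof.
move=> ww' [ij nj]; split; first exact: infinite_cluster_local ij.
by move=> i' /nj h c; apply: h; apply: conn_local c => e /ww'.
Qed.

(** Finite energy: a column rooted in the closed colour separates two infinite
    open clusters of H_k.  Each contains an infinite cluster of H_(k+1), and
    after merging them along row k the new cluster contains both. *)
Lemma two_children w k : (forall s, regular (symdiff (faces s) w) k) ->
  regular w k -> regular w (k + 1) -> (exists i, infinite_cluster w k (i, k)) ->
  exists s i j j', [/\ j != j', child (symdiff (faces s) w) k i j &
                       child (symdiff (faces s) w) k i j'].
Proof.
move=> gs gk gk1 ex; have [ow gw] := gk; have [tl tc] := gw ex.
have [_ [q _ lq]] := tl 0; have [_ [c qc lc]] := tc q; have [_ [q' cq' lq']] := tl c.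
have nqq' : ~ conn w k (q, k) (q', k).
  by move=> h; exact: linked_rooted ow h qc cq' lq lq' lc.
have lm z : rooted w k z -> exists2 i, leftmost w k i & conn w k (z, k) (i, k).
  move=> [_ iz]; have [L [U bd]] := trace_bounded gk iz.
  by apply: (exists_leftmost (L := L) iz) => m /bd[].
have [i li qi] := lm _ lq; have [i' li' qi'] := lm _ lq'.
have [j [_ lj ij]] := exists_child gk gk1 li.
have [j' [_ lj' ij']] := exists_child gk gk1 li'.
have nii' : ~ conn w k (i, k) (i', k).
  move=> h; apply: nqq'; apply: conn_trans qi _; apply: conn_trans h _.
  exact: conn_sym.
have jj' : j != j'.
  apply/eqP => e; subst j'; apply: nii'; apply: conn_trans ij _; exact: conn_sym.
have [s [w'E w'i ci]] : exists s : seq vertex, let w' := symdiff (faces s) w in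
    [/\ forall e, k + 1 <= e.1.2 -> w' e = w e,
      forall e, k <= e.1.2 -> w e -> w' e & conn w' k (i, k) (i', k)].
  have [lt|/ltW lt] := leP i i'; first exact: merge_clusters.
  have [s [h1 h2 h3]] := merge_clusters w k lt.
  by exists s; split=> //; exact: conn_sym.
set w' := symdiff (faces s) w in w'E w'i ci.
have sub x y : conn w k x y -> conn w' k x y.
  apply: conn_sub => u v _ _ /adjP[e [ke we uv]].
  by apply/adjP; exists e; split=> //; exact: w'i.
have ii : infinite_cluster w' k (i, k).
  by case: li => ii _; apply: infinite_cluster_sub ii => v; exact: sub.
have [L [U bd]] := trace_bounded (gs s) ii.
have [|i0 li0 ci0] := exists_leftmost (L := L) ii; first by move=> m /bd[].
exists s, i0, j, j'; split => //; split=> //.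
- by apply: leftmost_local lj => e /w'E.
- by apply: conn_trans (conn_sym ci0) _; exact: sub.
- by apply: leftmost_local lj' => e /w'E.
- apply: conn_trans (conn_sym ci0) _; apply: conn_trans ci _; exact: sub.
Qed.

(** * Measurability *)

Lemma measurable_exists (T : countType) (P : T -> config edge -> Prop) :
  (forall t, measurable [set w | P t w]) ->
  measurable [set w | exists t, P t w].
Proof.
move=> mP; rewrite (_ : [set w | _] = \bigcup_t [set w | P t w]).
  exact: countable_bigcupT_measurable.
by apply/seteqP; split=> w /= [t]; exists t.
Qed.

Lemma measurable_not (P : config edge -> Prop) :
  measurable [set w | P w] -> measurable [set w | ~ P w].
Proof. exact: measurableC. Qed.

Lemma measurable_conj (P P' : config edge -> Prop) :
  measurable [set w | P w] -> measurable [set w | P' w] ->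
  measurable [set w | P w /\ P' w].
Proof. exact: measurableI. Qed.

Lemma measurable_const (P : Prop) : measurable [set w : config edge | P].
Proof.
have [p|np] := pselect P.
  rewrite (_ : [set _ | _] = setT); first exact: measurableT.
  by apply/seteqP; split.
rewrite (_ : [set _ | _] = set0); first exact: measurable0.
by apply/seteqP; split.
Qed.

Lemma measurable_imply (P P' : config edge -> Prop) :
  measurable [set w | P w] -> measurable [set w | P' w] ->
  measurable [set w | P w -> P' w].
Proof.
move=> mP mP'; rewrite (_ : [set w | _] = ~` [set w | P w] `|` [set w | P' w]).
  by apply: measurableU => //; exact: measurableC.
apply/seteqP; split=> w /=; last by case.
by move=> h; have [/h|] := pselect (P w); [right|left].
Qed.

Lemma measurable_forall (T : countType) (P : T -> config edge -> Prop) :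
  (forall t, measurable [set w | P t w]) ->
  measurable [set w | forall t, P t w].
Proof.
move=> mP; rewrite (_ : [set w | _] = [set w | ~ exists t, ~ P t w]).
  apply: measurable_not; apply: measurable_exists => t; exact: measurable_not.
apply/seteqP; split=> w /=; first by move=> h [t]; apply.
by move=> h t; apply: contrapT => n; apply: h; exists t.
Qed.

Lemma measurable_open (e : edge) : measurable [set w : config edge | w e].
Proof. by apply: sub_sigma_algebra; exists e. Qed.

Lemma measurable_conn k u v : measurable [set w | conn w k u v].
Proof.
rewrite (_ : [set w | _] = [set w | exists p : seq (int * int),
    path (adj w k) u p /\ last u p = v]); last first.
  by apply/seteqP; split=> w /= [p]; [exists p|move=> [? ?]; exists p].
apply: (@measurable_exists (seq (int * int))) => p.
apply: measurable_conj; last exact: measurable_const.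
elim: p u => [|x p IH] u; first exact: (measurable_const true).
rewrite (_ : [set w | _] = [set w : config edge | (exists e : (int * int) * bool,
    (k <= e.1.2 /\ ((u = source e /\ x = target e) \/
                    (u = target e /\ x = source e))) /\ w e) /\
    path (adj w k) x p]); last first.
  apply/seteqP; split=> w /=.
    by move=> /andP[/adjP[e [? ? ?]] ?]; split=> //; exists e.
  move=> [[e [[h1 h2] h3]] ->]; rewrite andbT; apply/adjP.
  by exists e.
apply: measurable_conj; last exact: IH.
apply: (@measurable_exists ((int * int) * bool)%type) => e.
apply: measurable_conj; first exact: measurable_const.
exact: measurable_open.
Qed.

Lemma measurable_infinite k u : measurable [set w | infinite_cluster w k u].
Proof.
rewrite (_ : [set w | _] = [set w | forall s : seq (int * int),
    exists v : int * int, v \notin s /\ conn w k u v]); last first.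
  apply/seteqP; split=> w /= h s; have := h s; first by move=> [v]; exists v.
  by move=> [v []]; exists v.
apply: (@measurable_forall (seq (int * int))) => s.
apply: (@measurable_exists (int * int)%type) => v.
by apply: measurable_conj; [exact: measurable_const|exact: measurable_conn].
Qed.

Lemma measurable_rooted k i : measurable [set w | rooted w k i].
Proof.
apply: measurable_conj; last exact: measurable_infinite.
exact: measurable_open.
Qed.

Lemma measurable_leftmost k i : measurable [set w | leftmost w k i].
Proof.
apply: measurable_conj; first exact: measurable_infinite.
apply: (@measurable_forall int) => j; apply: measurable_imply; first exact: measurable_const.
by apply: measurable_not; exact: measurable_conn.
Qed.

Lemma measurable_child k i j : measurable [set w | child w k i j].
Proof.
rewrite (_ : [set w | _] = [set w | leftmost w k i /\
    (leftmost w (k + 1) j /\ conn w k (i, k) (j, k + 1))]); last first.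
  by apply/seteqP; split=> w /= [h1]; [|move=> [? ?]].
apply: measurable_conj; first exact: measurable_leftmost.
apply: measurable_conj; first exact: measurable_leftmost.
exact: measurable_conn.
Qed.

(** * Translations and symmetric differences *)

Definition translate (s t : int) (w : config edge) : config edge :=
  fun e => w ((e.1.1 + s, e.1.2 + t), e.2).

Lemma measurable_translate s t : measurable_fun [set: config edge] (translate s t).
Proof. by apply: measurable_fun_config => e; exact: measurable_coordinate. Qed.

HB.instance Definition _ s t :=
  isMeasurableFun.Build _ _ _ _ (translate s t) (measurable_translate s t).

Definition move_vertex (s t : int) (u : vertex) : vertex := (u.1 + s, u.2 + t).

Lemma move_vertexK s t : cancel (move_vertex (- s) (- t)) (move_vertex s t).
Proof. by case=> a b; rewrite /move_vertex /= !subrK. Qed.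

Lemma move_vertexVK s t : cancel (move_vertex s t) (move_vertex (- s) (- t)).
Proof. by case=> a b; rewrite /move_vertex /= !addrK. Qed.

Lemma adj_translate s t w k x y :
  adj (translate s t w) k x y = adj w (k + t) (move_vertex s t x) (move_vertex s t y).
Proof.
case: x y => a b [c d]; rewrite /adj /step /translate /move_vertex /= !lerD2r.
have eqD (x y z : int) : (x + z == y + z) = (x == y) by rewrite (inj_eq (addIr z)).
by rewrite -!(addrAC _ 1) !eqD.
Qed.

Lemma conn_map (f : vertex -> vertex) w w' k k' u v :
  (forall x y, adj w k x y -> adj w' k' (f x) (f y)) ->
  conn w k u v -> conn w' k' (f u) (f v).
Proof.
move=> hf; move: v; apply: conn_ind; first exact: conn_refl.
by move=> x y _ h /hf/conn_adj; exact: conn_trans.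
Qed.

Lemma conn_translate s t w k x y : conn (translate s t w) k x y <->
  conn w (k + t) (move_vertex s t x) (move_vertex s t y).
Proof.
split; first by apply: conn_map => u v; rewrite adj_translate.
rewrite -{2}(move_vertexVK s t x) -{2}(move_vertexVK s t y).
by apply: conn_map => u v; rewrite adj_translate !move_vertexK.
Qed.

Lemma infinite_translate s t w k x : infinite_cluster (translate s t w) k x <->
  infinite_cluster w (k + t) (move_vertex s t x).
Proof.
split=> h r.
  have [v vr /conn_translate xv] := h (map (move_vertex (- s) (- t)) r).
  exists (move_vertex s t v) => //; apply: contra vr => vr.
  by apply/mapP; exists (move_vertex s t v); rewrite ?move_vertexVK.
have [v vr xv] := h (map (move_vertex s t) r).
exists (move_vertex (- s) (- t) v); last by apply/conn_translate; rewrite move_vertexK.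
apply: contra vr => vr.
by apply/mapP; exists (move_vertex (- s) (- t) v); rewrite ?move_vertexK.
Qed.

Lemma rooted_translate s w k i : rooted (translate s 0 w) k i <-> rooted w k (i + s).
Proof.
rewrite /rooted infinite_translate /dangling /translate /move_vertex /=.
by rewrite !addr0.
Qed.

Lemma leftmost_translate s t w k i :
  leftmost (translate s t w) k i <-> leftmost w (k + t) (i + s).
Proof.
rewrite /leftmost infinite_translate /move_vertex /=.
split=> -[h1 h2]; split=> // j ji.
  have := h2 (j - s); rewrite conn_translate /move_vertex /= subrK; apply; lia.
by rewrite conn_translate /move_vertex /=; apply: h2; lia.
Qed.

Lemma child_translate s w k i j : child (translate s 0 w) k i j <-> child w k (i + s) (j + s).
Proof.
have h1 := leftmost_translate s 0 w k i; have h2 := leftmost_translate s 0 w (k + 1) j.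
have h3 := conn_translate s 0 w k (i, k) (j, k + 1).
rewrite /move_vertex /= !addr0 in h1 h2 h3.
by split=> -[? ? ?]; split; first [exact/h1|exact/h2|exact/h3].
Qed.

Lemma odd_degree_symdiff g w v :
  odd (degree (symdiff g w) v) = odd (degree g v) (+) odd (degree w v).
Proof.
case: v => a b; rewrite !degreeE /symdiff !oddD !oddb.
by do 8![case: (_ (_, _))].
Qed.

Lemma symdiffA (E : Type) (f g h : config E) :
  symdiff f (symdiff g h) = symdiff (symdiff f g) h.
Proof. by apply/funext => e; rewrite /symdiff addbA. Qed.

Lemma symdiffC (E : Type) (f g : config E) : symdiff f g = symdiff g f.
Proof. by apply/funext => e; rewrite /symdiff addbC. Qed.

Lemma symdiffK (E : Type) (g w : config E) : symdiff g (symdiff g w) = w.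
Proof. by apply/funext => e; rewrite /symdiff addKb. Qed.

Lemma even_symdiff_odd h w : odd_subgraph h -> odd_subgraph w ->
  even_subgraph (symdiff h w).
Proof. by move=> oh ow v; rewrite odd_degree_symdiff oh ow. Qed.

Lemma odd_translate s t w : odd_subgraph w -> odd_subgraph (translate s t w).
Proof.
move=> ow [a b]; have := ow (a + s, b + t).
by rewrite !degreeE /translate /= !(addrAC _ (- 1)).
Qed.

Lemma even_translate s t w : even_subgraph w -> even_subgraph (translate s t w).
Proof.
move=> ow [a b]; have := ow (a + s, b + t).
by rewrite !degreeE /translate /= !(addrAC _ (- 1)).
Qed.

Lemma measurable_odd_subgraph h : odd_subgraph h -> measurable odd_subgraph.
Proof.
move=> oh; rewrite (_ : odd_subgraph = symdiff h @^-1` even_subgraph).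
  rewrite -[X in measurable X]setTI.
  exact: (measurable_symdiff h measurableT measurable_even_subgraph).
apply/seteqP; split=> w /=; first exact: even_symdiff_odd.
by move=> ew v; have := ew v; rewrite odd_degree_symdiff oh negbK.
Qed.

(** * Invariance of the uniform odd subgraph *)

Definition preserves d (T : measurableType d) (R : realType)
    (Q : probability T R) (f : T -> T) : Prop :=
  measurable_fun setT f /\
  forall A, measurable A -> Q (f @^-1` A) = Q A.

Lemma ae_preserves d (T : measurableType d) (R : realType)
    (Q : probability T R) (f : T -> T) (P : T -> Prop) :
  preserves Q f -> {ae Q, forall w, P w} -> {ae Q, forall w, P (f w)}.
Proof.
move=> [mf Qf] [N [mN N0 sub]]; exists (f @^-1` N); split.
- by rewrite -[X in measurable X]setTI; exact: mf.
- by rewrite Qf.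
- by move=> w /= h; apply: sub.
Qed.

Definition toggle_invariant (R : realType) (Q : probability (config edge) R) :=
  forall g, even_subgraph g -> preserves Q (symdiff g).

Lemma measurable_preimage d d' (T : measurableType d) (T' : measurableType d')
    (f : T -> T') A :
  measurable_fun setT f -> measurable A -> measurable (f @^-1` A).
Proof. by move=> mf mA; rewrite -[X in measurable X]setTI; exact: mf. Qed.

Lemma UOG_toggle_invariant (R : realType) (Q : probability (config edge) R) :
  is_UOG Q -> toggle_invariant Q.
Proof.
move=> [P [h [[_ inv] oh QP]]] g eg; split; first exact: measurable_symdiff.
move=> A mA; have ms g' A' : measurable A' -> measurable (symdiff (E := edge) g' @^-1` A').
  by apply: measurable_preimage; exact: measurable_symdiff.
rewrite !QP //; last exact: ms.
rewrite /distribution /pushforward /= -[RHS](inv g eg); last exact: ms.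
congr (P _); apply/seteqP; split=> w /=; by rewrite !symdiffA (symdiffC g h).
Qed.

Lemma UOG_odd (R : realType) (Q : probability (config edge) R) :
  is_UOG Q -> {ae Q, forall w, odd_subgraph w}.
Proof.
move=> [P [h [[P1 _] oh QP]]].
have mo := measurable_odd_subgraph oh.
have Q1 : Q odd_subgraph = 1%E.
  rewrite QP // /distribution /pushforward /= -P1; congr (P _).
  apply/seteqP; split=> w /=; last first.
    by move=> ew v; rewrite odd_degree_symdiff oh; exact: ew.
  by move=> ow v; have := ow v; rewrite odd_degree_symdiff oh.
exists (~` odd_subgraph); split => //; first exact: measurableC.
by rewrite probability_setC // Q1 subee.
Qed.

(** The odd subgraphs form a coset of the compact group of even subgraphs, and
    its invariant probability is unique for the usual reason: compute the law
    of w + w' + h, for independent w and w' of laws Q and Q', by conditioning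
    on either one of them. *)
Lemma toggle_invariant_unique (R : realType)
    (Q Q' : probability (config edge) R) (h : config edge) : odd_subgraph h ->
  toggle_invariant Q -> toggle_invariant Q' ->
  {ae Q, forall w, odd_subgraph w} -> {ae Q', forall w, odd_subgraph w} ->
  forall A, measurable A -> Q A = Q' A.
Proof.
move=> oh iQ iQ' oQ oQ' A mA.
pose F (z : config edge * config edge) : config edge :=
  symdiff z.1 (symdiff z.2 h).
have mF : measurable_fun setT F.
  apply: measurable_fun_config => e; rewrite /F /symdiff.
  have m1 : measurable_fun setT (fun z : config edge * config edge => z.1 e).
    apply: (measurableT_comp (f := fun w : config edge => w e)) => //.
    exact: measurable_coordinate.
  have m2 : measurable_fun setT (fun z : config edge * config edge => z.2 e).
    apply: (measurableT_comp (f := fun w : config edge => w e)) => //.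
    exact: measurable_coordinate.
  rewrite (_ : (fun z => _) = (fun z => (z.1 e && (z.2 e == h e)) ||
     (~~ z.1 e && (z.2 e != h e)))); last first.
    by apply/funext => z; case: (z.1 e) (z.2 e) (h e) => -[] [].
  have m3 : measurable_fun setT (fun z : config edge * config edge => z.2 e == h e).
    case: (h e).
      by rewrite (_ : (fun z => _) = (fun z : config edge * config edge => z.2 e)) //;
        apply/funext => z; rewrite eqb_id.
    rewrite (_ : (fun z => _) = (fun z : config edge * config edge => ~~ z.2 e)).
      exact: measurable_neg.
    by apply/funext => z; rewrite eqbF_neg.
  by apply: measurable_or; apply: measurable_and => //; exact: measurable_neg.
(* Given w' the sum w + (w' + h) has law Q, and given w it has law Q'. *)
have mX : measurable (F @^-1` A) by exact: measurable_preimage.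
have E := product_measure_unique (m1 := Q) (m2 := Q') (m' := (Q \x^ Q')%E)
  (fun B C mB mC => product_measure2E Q Q' mB mC) mX.
transitivity ((Q \x^ Q')%E (F @^-1` A)); last rewrite -E.
  rewrite /product_measure2; symmetry.
  rewrite (ae_eq_integral (cst (Q A))) //.
  - by rewrite integral_cst // -[RHS]mule1; congr (_ * _)%E; exact: probability_setT.
  - exact: measurable_fun_ysection.
  case: oQ' => N [mN N0 sub]; exists N; split=> // w' /= nw'; apply: sub => /= ow'.
  apply: nw' => _; have [_ inv] := iQ (symdiff w' h) (even_symdiff_odd ow' oh).
  rewrite -(inv A mA); congr (Q _).
  by apply/seteqP; split=> w /=; rewrite /ysection /= inE /F /= symdiffC.
rewrite /product_measure1 (ae_eq_integral (cst (Q' A))) //.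
- by rewrite integral_cst // -[RHS]mule1; congr (_ * _)%E; exact: probability_setT.
- exact: measurable_fun_xsection.
case: oQ => N [mN N0 sub]; exists N; split=> // w /= nw; apply: sub => /= ow.
apply: nw => _; have [_ inv] := iQ' (symdiff w h) (even_symdiff_odd ow oh).
rewrite -(inv A mA); congr (Q' _).
apply/seteqP; split=> w' /=; rewrite /xsection /= inE /F /=;
  by rewrite (symdiffC w' h) symdiffA.
Qed.

Definition translation_invariant (R : realType) (Q : probability (config edge) R) :=
  forall s t, preserves Q (translate s t).

Lemma translate_symdiff s t (g w : config edge) :
  translate s t (@symdiff edge g w) = @symdiff edge (translate s t g) (translate s t w).
Proof. by []. Qed.

Lemma translateVK s t : cancel (translate (- s) (- t)) (translate s t).
Proof.
by move=> w; apply/funext => -[[a b] d]; rewrite /translate /= !addrK.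
Qed.

(** The translated measure is again an invariant probability on odd subgraphs. *)
Lemma UOG_translation_invariant (R : realType) (Q : probability (config edge) R) :
  is_UOG Q -> translation_invariant Q.
Proof.
move=> uQ s t; split; first exact: measurable_translate.
have iQ := UOG_toggle_invariant uQ; have oQ := UOG_odd uQ.
have [_ [h [_ oh _]]] := uQ.
have mp A : measurable A -> measurable (translate s t @^-1` A).
  by apply: measurable_preimage; exact: measurable_translate.
apply: (toggle_invariant_unique (Q := distribution Q (translate s t)) oh) => //.
- move=> g eg; split; first exact: measurable_symdiff.
  move=> A mA; rewrite /distribution /pushforward /=.
  have eg' : even_subgraph (translate (- s) (- t) g) by exact: even_translate.
  have [_ inv] := iQ _ eg'; rewrite -[RHS]inv; last exact: mp.
  congr (Q _); apply/seteqP; split=> w /=;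
    by rewrite translate_symdiff translateVK.
have mo := measurable_odd_subgraph oh.
case: oQ => N [mN N0 sub]; exists (~` odd_subgraph); split => //.
  exact: measurableC.
apply/eqP; rewrite eq_le measure_ge0 andbT -N0 /distribution /pushforward /=.
apply: (@le_measure _ _ _ Q); rewrite ?inE //.
  by apply: (mp (~` odd_subgraph)); exact: measurableC.
by move=> w /= now; apply: sub => /= ow; apply: now; exact: odd_translate.
Qed.

(** * Stationarity *)

Lemma equiprobable_disjoint d (T : measurableType d) (R : realType)
    (Q : probability T R) (F : nat -> set T) :
  (forall n, measurable (F n)) -> trivIset setT F ->
  (forall n, Q (F n) = Q (F 0)) -> Q (F 0) = 0.
Proof.
move=> mF tF QF.
have fin : Q (F 0) \is a fin_num by exact: fin_num_measure.
have bd n : (fine (Q (F 0)) *+ n <= 1).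
  rewrite -lee_fin EFin_natmul fineK //.
  have mU : measurable (\big[setU/set0]_(i < n) F i) by exact: bigsetU_measurable.
  have := probability_le1 Q mU; rewrite measure_bigsetU //.
  rewrite (eq_bigr (fun=> Q (F 0))); last by move=> i _; exact: QF.
  by rewrite big_const_ord iter_addr_0.
rewrite -(fineK fin); congr (_%:E); apply/eqP; rewrite eq_le fine_ge0 // andbT.
rewrite leNgt; apply/negP => pos.
have := bd (Num.bound (fine (Q (F 0)))^-1); rewrite leNgt => /negP; apply.
rewrite -mulr_natl -ltr_pdivrMr // div1r.
by apply: archi_boundP; rewrite invr_ge0 ltW.
Qed.

Lemma ae_forall (T : countType) d (S : measurableType d) (R : realType)
    (Q : probability S R) (P : T -> S -> Prop) :
  (forall t, {ae Q, forall w, P t w}) -> {ae Q, forall w, forall t, P t w}.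
Proof.
move=> aeP.
have := @ae_foralln _ _ _ Q (fun n w => if unpickle n is Some t then P t w else True).
move=> H; apply: filterS (H _) => [w h t|n]; first by have := h (pickle t); rewrite pickleK.
by case: (unpickle n) => [t|]; [exact: aeP|exact: aeW].
Qed.

Lemma ae_and d (S : measurableType d) (R : realType) (Q : probability S R)
    (P P' : S -> Prop) :
  {ae Q, forall w, P w} -> {ae Q, forall w, P' w} ->
  {ae Q, forall w, P w /\ P' w}.
Proof. by move=> h h'; apply: filterS2 h h' => w. Qed.

Lemma ae_imp d (S : measurableType d) (R : realType) (Q : probability S R)
    (P P' : S -> Prop) :
  (forall w, P w -> P' w) -> {ae Q, forall w, P w} -> {ae Q, forall w, P' w}.
Proof. by move=> sub; apply: filterS. Qed.

(** For the two orders of the integers taken as lt, a stationary random set of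
    columns has no last element: the events that i is the last one are
    disjoint and equiprobable. *)
Lemma stationary_unbounded (R : realType) (Q : probability (config edge) R)
    (P : config edge -> int -> Prop) (lt : rel int) :
  translation_invariant Q ->
  (forall i, measurable [set w | P w i]) ->
  (forall s w i, P (translate s 0 w) i <-> P w (i + s)) ->
  (forall i j, i != j -> lt i j || lt j i) ->
  (forall i j s, lt (i + s) (j + s) = lt i j) ->
  {ae Q, forall w, forall i, P w i -> exists2 j, lt i j & P w j}.
Proof.
move=> tQ mP tP total trl.
pose B i := [set w | P w i /\ forall j, lt i j -> ~ P w j].
have mB i : measurable (B i).
  apply: measurable_conj; first exact: mP.
  apply: (@measurable_forall int) => j; apply: measurable_imply.
    exact: measurable_const.
  by apply: measurable_not; exact: mP.
have QB i : Q (B i) = Q (B 0).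
  rewrite -[RHS](proj2 (tQ i 0) _ (mB 0)); congr (Q _).
  apply/seteqP; split=> w [/= h1 h2]; split.
  - by apply/tP; rewrite add0r.
  - by move=> j lj /tP; apply: h2; rewrite -{1}(add0r i) trl.
  - by move/tP: h1; rewrite add0r.
  - move=> j ij Pj; apply: (h2 (j - i)); last by apply/tP; rewrite subrK.
    by rewrite -(trl _ _ i) add0r subrK.
have B0 : Q (B 0) = 0.
  apply: (equiprobable_disjoint (F := fun n => B n%:Z)) => //.
  move=> m n _ _ [w [[/= h1 h2] [h3 h4]]]; apply/eqP/negPn/negP => mn.
  have /total/orP[l|l] : m%:Z != n%:Z by []; first exact: h2 l h3.
  exact: h4 l h1.
apply: (@ae_forall int) => i; exists (B i); split=> //; first by rewrite QB.
move=> w /= /not_implyP[Pi no]; split=> // j ij Pj; apply: no.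
by exists j.
Qed.

Lemma int_unbounded_below (P : int -> Prop) : (exists i, P i) ->
  (forall i, P i -> exists2 j, j < i & P j) -> forall n, exists2 i, i < n & P i.
Proof.
move=> [i Pi] dec n.
have [m] : exists m : nat, i - m%:Z < n by exists (absz (i - n)).+1; lia.
elim: m i Pi => [|m IH] i Pi im; first by exists i => //; lia.
by have [j ji Pj] := dec i Pi; apply: (IH j) => //; lia.
Qed.

Lemma int_unbounded_above (P : int -> Prop) : (exists i, P i) ->
  (forall i, P i -> exists2 j, i < j & P j) -> forall n, exists2 i, n < i & P i.
Proof.
move=> [i Pi] inc n.
have [||j jn Pj] := @int_unbounded_below (fun j => P (- j)) _ _ (- n).
- by exists (- i); rewrite opprK.
- by move=> j /inc[j' jj' Pj']; exists (- j'); rewrite ?opprK //; lia.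
- by exists (- j) => //; lia.
Qed.

Lemma two_sided_infinitely_many P : two_sided P -> infinitely_many P.
Proof.
move=> ts s; have [M hM] : exists M, forall i, i \in s -> i <= M.
  elim: s => [|i s [M hM]]; first by exists 0.
  exists (`|i| + `|M|) => j; rewrite inE => /orP[/eqP ->|/hM]; lia.
have [_ [i Mi Pi]] := ts M; exists i => //.
by apply/negP => /hM; lia.
Qed.

Lemma ae_rooted_two_sided (R : realType) (Q : probability (config edge) R) k :
  translation_invariant Q ->
  {ae Q, forall w, (exists i, rooted w k i) -> two_sided (rooted w k)}.
Proof.
move=> tQ.
have lo := stationary_unbounded (P := fun w i => rooted w k i) (lt := fun i j => j < i) tQ.
have hi := stationary_unbounded (P := fun w i => rooted w k i) (lt := fun i j => i < j) tQ.
have {}lo := lo (measurable_rooted k) (fun s w i => rooted_translate s w k i).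
have {}hi := hi (measurable_rooted k) (fun s w i => rooted_translate s w k i).
apply: ae_imp (ae_and (lo _ _) (hi _ _)).
- by move=> w [h1 h2] ex n; split;
    [exact: int_unbounded_below|exact: int_unbounded_above].
- by move=> i j; rewrite orbC -neq_lt.
- by move=> i j s; rewrite ltrD2r.
- by move=> i j; rewrite -neq_lt.
- by move=> i j s; rewrite ltrD2r.
Qed.

(** * Symmetry between open and closed *)

Definition all_open : config edge := fun=> true.

Lemma symdiff_all_open w : symdiff all_open w = compl w.
Proof. by []. Qed.

Lemma even_all_open : even_subgraph all_open.
Proof. by case=> a b; rewrite degreeE. Qed.

(** The face next to e that is black on a chessboard: the boundaries of the black
    faces partition the edges, so that all edges together are a limit of
    finite sums of face boundaries. *)
Definition black_face (e : edge) : vertex :=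
  let: ((a, b), d) := e in
  if ~~ odd (absz (a + b)) then (a, b) else if d then (a - 1, b) else (a, b - 1).

Lemma faces_black (s : seq edge) e : e \in s -> faces (map black_face s) e.
Proof.
move=> es; have bs : black_face e \in map black_face s by exact: map_f.
have ev p : p \in map black_face s -> ~~ odd (absz (p.1 + p.2)).
  move=> /mapP[[[a b] d] _ ->] /=.
  case: ifPn => [//|/negPn]; case: d => /=; lia.
have white p : odd (absz (p.1 + p.2)) -> (p \in map black_face s) = false.
  by move=> par; apply/negP => /ev; rewrite par.
case: e es bs => -[a b] d _ /=; case: ifPn => [par ->|/negPn par].
  by case: d; rewrite white //=; lia.
by case: d => ->; rewrite white.
Qed.

(** On finitely many edges complementation agrees with toggling finitely many
    black faces, which does not affect A.  Hence B and its preimage under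
    complementation have the same probability inside A, for cylinders B and
    then for all measurable B; take for B the complement of A. *)
Lemma ae_tail_compl (R : realType) (Q : probability (config edge) R)
    (A : set (config edge)) :
  toggle_invariant Q -> measurable A ->
  (forall s w, A w -> A (symdiff (faces s) w)) ->
  {ae Q, forall w, A w -> A (compl w)}.
Proof.
move=> iQ mA tailA.
pose G : set (set (config edge)) :=
  [set B | exists s : seq edge, B = [set w : config edge | all w s]].
pose m1 : {measure set (config edge) -> \bar R} := mrestr Q mA.
pose m2_ : {measure set (config edge) -> \bar R} :=
  pushforward (mrestr Q mA) (symdiff all_open).
pose m2 := m2_ (measurable_symdiff all_open).
have mG : (@measurable _ (config edge)) = <<s G >>.
  apply/seteqP; split.
    apply: smallest_sub; first exact: smallest_sigma_algebra.
    move=> _ [e ->]; apply: sub_sigma_algebra; exists [:: e].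
    by apply/seteqP; split=> w /=; rewrite andbT.
  apply: smallest_sub; first exact: sigma_algebra_measurable.
  move=> _ [s ->]; elim: s => [|e s IH].
    rewrite (_ : [set w | _] = setT); first exact: measurableT.
    by apply/seteqP; split.
  rewrite (_ : [set w | _] = [set w : config edge | w e] `&` [set w : config edge | all w s]).
    by apply: measurableI IH; exact: measurable_open.
  by apply/seteqP; split=> w /= => [/andP|/andP].
have GI : setI_closed G.
  move=> _ _ [s ->] [t ->]; exists (s ++ t).
  by apply/seteqP; split=> w /=; rewrite all_cat => /andP.
have GT : G setT by exists [::]; apply/seteqP; split.
have m12 B : G B -> m1 B = m2 B.
  move=> [s ->].
  have mB : measurable [set w : config edge | all w s].
    by rewrite mG; apply: sub_sigma_algebra; exists s.
  (* toggling g complements the edges of s *)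
  pose g := faces (map black_face s).
  have [_ inv] := iQ g (even_boundary _).
  have gE w : all (symdiff g w) s = all (compl w) s.
    by apply: eq_in_all => e es; rewrite /symdiff /g faces_black.
  rewrite /m1 /m2 /m2_ /= /pushforward /mrestr /= -inv; last exact: measurableI.
  congr (Q _); apply/seteqP; split=> w /= [h1 h2].
    by rewrite symdiff_all_open -gE; split=> //; rewrite -(symdiffK g w); exact: tailA.
  by rewrite gE -symdiff_all_open; split=> //; exact: tailA.
have m12A : m1 (~` A) = m2 (~` A).
  apply: (measure_unique G (fun=> setT)) => //.
  - by rewrite bigcup_const.
  - move=> _; rewrite /m1 /= /mrestr setTI.
    by rewrite (le_lt_trans (probability_le1 Q mA)) // ltry.
  - exact: measurableC.
exists (symdiff all_open @^-1` (~` A) `&` A); split.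
- apply: measurableI => //.
  by apply: measurable_preimage; [exact: measurable_symdiff|exact: measurableC].
- by move: m12A; rewrite /m1 /m2 /m2_ /= /pushforward /mrestr setICl measure0 => <-.
- by move=> w /= /not_implyP[Aw nAw].
Qed.

(** An infinite cluster meeting row k roots a column after the modification of at
    most one face.  By stationarity the rooted columns of the modified
    configuration are infinite in number, hence so are those of the original
    one, and then those of its complement. *)
Lemma ae_regular (R : realType) (Q : probability (config edge) R) k :
  toggle_invariant Q -> translation_invariant Q ->
  {ae Q, forall w, odd_subgraph w} -> {ae Q, forall w, regular w k}.
Proof.
move=> iQ tQ oQ.
have ts := ae_rooted_two_sided k tQ.
have tsc : {ae Q, forall w, (exists i, rooted (compl w) k i) ->
    two_sided (rooted (compl w) k)}.
  exact: (ae_preserves (iQ _ even_all_open) ts).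
have tsf : {ae Q, forall w, forall s : seq (int * int),
    (exists i, rooted (symdiff (faces s) w) k i) ->
    two_sided (rooted (symdiff (faces s) w) k)}.
  apply: ae_forall => s.
  exact: (ae_preserves (iQ (faces s) (even_boundary _)) ts).
have tail : {ae Q, forall w, infinitely_many (rooted w k) ->
    infinitely_many (rooted (compl w) k)}.
  apply: (@ae_tail_compl _ _ [set w | infinitely_many (rooted w k)]) => //.
    rewrite (_ : [set w | _] = [set w | forall s : seq int,
       exists i : int, i \notin s /\ rooted w k i]); last first.
      apply/seteqP; split=> w /= h s; have := h s; first by move=> [v]; exists v.
      by move=> [v []]; exists v.
    apply: (@measurable_forall (seq int)) => s.
    apply: (@measurable_exists int) => i.
    by apply: measurable_conj; [exact: measurable_const|exact: measurable_rooted].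
  move=> s w /=; have [G fG] := faces_finite s.
  exact: rooted_finite_toggle fG.
apply: ae_imp (ae_and oQ (ae_and ts (ae_and tsc (ae_and tsf tail)))).
move=> w [ow [tsw [tscw [tsfw tailw]]]]; split=> // -[i ii].
suff inf : infinitely_many (rooted w k).
  split; first by apply: tsw; have [j _ lj] := inf [::]; exists j.
  by apply: tscw; have [j _ lj] := tailw inf [::]; exists j.
have [i' [li'|li']] := rooted_or_toggle ii.
  by apply: two_sided_infinitely_many; apply: tsw; exists i'.
rewrite -(symdiffK (faces [:: (i, k - 1)]) w).
have [G fG] := faces_finite [:: (i, k - 1)].
apply: rooted_finite_toggle fG _; apply: two_sided_infinitely_many.
by apply: tsfw; exists i'.
Qed.

(** * Mass transport *)

(** Replacing M m by M m minus M n keeps the union but lowers the sum of the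
    probabilities by the probability of the overlap. *)
Lemma null_overlap d (T : measurableType d) (R : realType)
    (Q : probability T R) (M : nat -> set T) :
  (forall n, measurable (M n)) ->
  (\sum_(0 <= n <oo) Q (M n) <= Q (\bigcup_n M n))%E ->
  forall m n, m != n -> Q (M m `&` M n) = 0.
Proof.
move=> mM le m n mn.
pose M' j := if j == m then M m `\` M n else M j.
have mM' j : measurable (M' j).
  by rewrite /M'; case: ifP => _ //; exact: measurableD.
have U : \bigcup_j M j = \bigcup_j M' j.
  apply/seteqP; split=> x [j _ Mj].
    have [Mn|nMn] := pselect (M n x).
      by exists n => //; rewrite /M' eq_sym (negPf mn).
    exists j => //; rewrite /M'; case: eqP => // jm; subst j.
    by split.
  by move: Mj; rewrite /M'; case: eqP => [_ [Mm _]|_ Mj]; [exists m|exists j].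
have mU : measurable (\bigcup_j M' j) by exact: bigcupT_measurable.
have sub : (Q (\bigcup_j M' j) <= \sum_(0 <= j <oo) Q (M' j))%E.
  exact: measure_sigma_subadditive.
rewrite U (nneseriesD1 (n := m)) // in le.
rewrite (nneseriesD1 (n := m)) // in sub.
rewrite [in X in (_ <= _ + X)%E](eq_eseriesr (g := fun j => Q (M j))) in sub; last first.
  by move=> j /= /negPf jm; rewrite /M' jm.
set S := (\sum_(0 <= j <oo | _) Q (M j))%E in le sub.
have S0 : (0 <= S)%E by apply: nneseries_ge0 => j _ _; exact: measure_ge0.
have finM A : measurable A -> Q A \is a fin_num by move=> mA; exact: fin_num_measure.
have finS : S \is a fin_num.
  rewrite ge0_fin_numE //; apply: (@le_lt_trans _ _ 1%E); last exact: ltry.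
  apply: le_trans (probability_le1 Q mU); apply: le_trans le.
  by rewrite leeDr.
have := le_trans le sub; rewrite leeD2rE // /M' eqxx measureD //; last first.
  by rewrite -ge0_fin_numE // finM.
rewrite leeBrDr ?finM //; last exact: measurableI.
rewrite -[leRHS]adde0 leeD2lE ?finM // => h.
by apply/eqP; rewrite eq_le h measure_ge0.
Qed.

Lemma leftmost_unique w k i i' : leftmost w k i -> leftmost w k i' ->
  conn w k (i, k) (i', k) -> i = i'.
Proof.
move=> [_ h] [_ h'] c; apply/eqP; rewrite eq_le !leNgt.
by apply/andP; split; apply/negP => /[dup] lt; [move/h|move/h'; move/(_ (conn_sym c))].
Qed.

(** The expected number of children of the label 0 of H_k is, by translation, the
    probability that the label 0 of H_(k+1) exists and has a parent, a parent
    being unique.  This is at most the probability that 0 is a label of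
    H_(k+1), which equals the probability that 0 is a label of H_k, hence is
    at most the probability that 0 has a child. *)
Lemma ae_unique_child (R : realType) (Q : probability (config edge) R) k :
  translation_invariant Q -> {ae Q, forall w, regular w k} ->
  {ae Q, forall w, regular w (k + 1)} ->
  {ae Q, forall w, forall i j j', child w k i j -> child w k i j' -> j = j'}.
Proof.
move=> tQ gk gk1.
suff h0 : {ae Q, forall w, forall z : int * int, z.1 != z.2 ->
    ~ (child w k 0 z.1 /\ child w k 0 z.2)}.
  have : {ae Q, forall w, forall i : int, forall z : int * int, z.1 != z.2 ->
    ~ (child (translate i 0 w) k 0 z.1 /\ child (translate i 0 w) k 0 z.2)}.
    by apply: ae_forall => i; exact: (ae_preserves (tQ i 0) h0).
  apply: ae_imp => w h i j j' c c'; apply/eqP/negPn/negP => jj'.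
  apply: (h i (j - i, j' - i)); first by rewrite /= (inj_eq (addIr _)).
  by split; apply/child_translate; rewrite add0r /= subrK.
(* M enumerates the possible children j of 0, and M' the possible parents -j
   of 0. *)
pose M n := if pickle_inv n is Some j then [set w | child w k 0 j] else set0.
pose M' n := if pickle_inv n is Some j then [set w | child w k (- j) 0] else set0.
have mM n : measurable (M n).
  by rewrite /M; case: (pickle_inv n) => [j|//]; exact: measurable_child.
have mM' n : measurable (M' n).
  by rewrite /M'; case: (pickle_inv n) => [j|//]; exact: measurable_child.
have QM n : Q (M n) = Q (M' n).
  rewrite -(proj2 (tQ (- odflt 0 (pickle_inv n)) 0) _ (mM n)); congr (Q _).
  rewrite /M /M'; case: (pickle_inv n) => [j|] /=; last by apply/seteqP; split.
  by apply/seteqP; split=> w /=; rewrite child_translate add0r subrr.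
have tM' : trivIset setT M'.
  move=> m n _ _ [w []]; rewrite /M'.
  have := @pickle_invK int m; have := @pickle_invK int n; rewrite /ocancel.
  case: (pickle_inv n) => [j /= <-|//]; case: (pickle_inv m) => [i /= <-|//].
  move=> [li _ ci] [lj _ cj]; congr pickle; apply: oppr_inj.
  by apply: leftmost_unique li lj _; apply: conn_trans ci _; exact: conn_sym.
have le : (\sum_(0 <= n <oo) Q (M n) <= Q (\bigcup_n M n))%E.
  rewrite (eq_eseriesr (g := fun n => Q (M' n))); last by move=> n _; exact: QM.
  rewrite -measure_semi_bigcup //; last exact: bigcupT_measurable.
  apply: (@le_trans _ _ (Q [set w | leftmost w (k + 1) 0])).
    apply: le_measure; rewrite ?inE; first exact: bigcupT_measurable.
      exact: measurable_leftmost.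
    by move=> w [n _]; rewrite /M'; case: (pickle_inv n) => [j [_]|].
  apply: (@le_trans _ _ (Q [set w | leftmost w k 0])).
    rewrite -(proj2 (tQ 0 1) _ (measurable_leftmost k 0)).
    rewrite le_eqVlt; apply/orP; left; apply/eqP; congr (Q _).
    by apply/seteqP; split=> w /=; rewrite leftmost_translate add0r.
  case: (ae_and gk gk1) => N [mN N0 sub].
  apply: (@le_trans _ _ (Q (\bigcup_n M n `|` N))).
    apply: le_measure; rewrite ?inE; first exact: measurable_leftmost.
      by apply: measurableU => //; exact: bigcupT_measurable.
    move=> w /= lw; have [gw|ngw] := pselect (regular w k /\ regular w (k + 1)).
      have [j cj] := exists_child gw.1 gw.2 lw.
      by left; exists (pickle j) => //; rewrite /M pickleK_inv.
    by right; exact: sub.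
  have := @measureU2 _ _ _ Q (\bigcup_n M n) N.
  move=> /(_ (bigcupT_measurable _ mM) mN) /le_trans; apply.
  rewrite -[leRHS]adde0; apply: leeD => //.
  by rewrite le_eqVlt; apply/orP; left; apply/eqP; exact: N0.
have null := null_overlap mM le.
apply: (@ae_forall (int * int)%type) => -[j j'] /=.
have [<-|jj'] := eqVneq j j'; first exact: aeW.
exists (M (pickle j) `&` M (pickle j')); split.
- exact: measurableI.
- by apply: null; rewrite (inj_eq (pcan_inj pickleK)).
- by move=> w /= /not_implyP[_ /contrapT]; rewrite /M !pickleK_inv.
Qed.

Lemma ae_no_infinite_cluster (R : realType) (Q : probability (config edge) R) k :
  toggle_invariant Q -> translation_invariant Q ->
  {ae Q, forall w, odd_subgraph w} ->
  {ae Q, forall w, forall i, ~ infinite_cluster w k (i, k)}.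
Proof.
move=> iQ tQ oQ.
have gk := ae_regular k iQ tQ oQ; have gk1 := ae_regular (k + 1) iQ tQ oQ.
have uc := ae_unique_child tQ gk gk1.
have faces_ae P : {ae Q, forall w, P w} ->
    {ae Q, forall w, forall s : seq (int * int), P (symdiff (faces s) w)}.
  move=> aeP; apply: ae_forall => s.
  exact: (ae_preserves (iQ (faces s) (even_boundary _)) aeP).
apply: ae_imp (ae_and gk (ae_and gk1 (ae_and (faces_ae _ gk) (faces_ae _ uc)))).
move=> w [gw [gw1 [gfw ufw]]] i ii.
have [|s [a [j [j' [jj' c c']]]]] := two_children gfw gw gw1; first by exists i.
by move: jj'; rewrite (ufw _ _ _ _ c c') eqxx.
Qed.

(** * The half-plane *)

(** A measurable way of reading a half-plane configuration in the plane; it turns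
    a null event of the plane into a null event of the half-plane. *)
Definition extend (w : config hp_edge) : config edge := fun e =>
  if pselect (half_plane (source e) /\ half_plane (target e)) is left h
  then w (exist _ e h) else false.

Lemma measurable_extend : measurable_fun setT extend.
Proof.
apply: measurable_fun_config => e; rewrite /extend.
case: pselect => h; last exact: measurable_cst.
exact: measurable_coordinate.
Qed.

Lemma target_row (e : edge) : e.1.2 <= (target e).2.
Proof. by case: e => -[a b] []; rewrite /target /generator /=; lia. Qed.

Lemma extend_hp_restriction w e : 0 <= e.1.2 -> extend (hp_restriction w) e = w e.
Proof.
move=> e0; rewrite /extend; case: pselect => // -[]; split => //=.
by apply: le_trans e0 (target_row e).
Qed.

Lemma hp_adjacent_adj w u v : hp_adjacent (hp_restriction w) u v -> adj w 0 u v.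
Proof.
move=> [[e [se te]] we uv]; apply/adjP; exists e; split=> //.
by case: uv => [|[-> ->]]; [left|right].
Qed.

Lemma lowest_row w (v : vertex) : 0 <= v.2 -> infinite_cluster w 0 v ->
  exists2 x : vertex, 0 <= x.2 & infinite_cluster w x.2 x.
Proof.
move=> v0 iv.
have exn : exists n : nat, `[< exists2 x : vertex, x.2 = n%:Z & conn w 0 v x >].
  exists (absz v.2); apply/asboolP; exists v; last exact: conn_refl.
  by case: (v) v0 => a b /=; lia.
have [n /asboolP[x xn vx] minn] := ex_minnP exn.
exists x; first by rewrite xn.
apply: infinite_cluster_sub (infinite_cluster_conn vx iv) => y.
have low z : conn w 0 x z -> x.2 <= z.2.
  move=> xz; have vz := conn_trans vx xz.
  have z0 := conn_row v0 vz; rewrite xn.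
  have := minn (absz z.2); have E : `|z.2|%N%:Z = z.2 by exact: gez0_abs.
  have ex : exists2 x0 : vertex, x0.2 = (absz z.2)%:Z & conn w 0 v x0.
    by exists z.
  by move=> /(_ (asboolT ex)); rewrite -lez_nat E.
apply: conn_sub => z z' xz _ zz'; have xz' : conn w 0 x z'.
  by apply: conn_trans xz _; exact: conn_adj.
by move: zz' => /and3P[_ _ st]; rewrite /adj st (low z) ?(low z').
Qed.

Lemma infinite_hp_cluster w : has_infinite_hp_cluster (hp_restriction w) ->
  exists x : vertex, 0 <= x.2 /\ infinite_cluster w x.2 x.
Proof.
move=> [C [v v0 ->] infC].
have sub u : hp_component (hp_restriction w) v u -> conn w 0 v u.
  elim=> [x y /hp_adjacent_adj/conn_adj //|x|x y z _ xy _ yz].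
    exact: conn_refl.
  exact: conn_trans yz.
have [|x x0 ix] := lowest_row (v := v) (w := w) v0; last by exists x.
move=> s; apply: contrapT => no; apply: infC.
apply: (@sub_finite_set _ _ [set` s]); last exact: finite_seq.
by move=> u /sub vu /=; apply/negPn/negP => us; apply: no; exists u.
Qed.

Theorem theorem4p2 (R : realType) (UOG : probability (config edge) R)
    (hUOG : is_UOG UOG) :
  {ae hp_marginal UOG, forall w, ~ has_infinite_hp_cluster w}.
Proof.
have iQ := UOG_toggle_invariant hUOG.
have tQ := UOG_translation_invariant hUOG.
have oQ := UOG_odd hUOG.
pose N := [set w | exists x : int * int, 0 <= x.2 /\ infinite_cluster w x.2 x].
have mN : measurable N.
  apply: (@measurable_exists (int * int)%type) => x.
  by apply: measurable_conj; [exact: measurable_const|exact: measurable_infinite].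
have locN w : N (extend (hp_restriction w)) <-> N w.
  have loc (x : vertex) e : 0 <= x.2 -> x.2 <= e.1.2 ->
      extend (hp_restriction w) e = w e.
    by move=> x0 xe; apply: extend_hp_restriction; exact: le_trans xe.
  split=> -[x [x0 ix]]; exists x; split=> //; apply: infinite_cluster_local ix;
    by move=> e /(loc x e x0).
have N0 : UOG N = 0.
  have : {ae UOG, forall w, forall k i : int, ~ infinite_cluster w k (i, k)}.
    by apply: (@ae_forall int) => k; exact: ae_no_infinite_cluster.
  move=> [N' [mN' N'0 sub]]; apply: (subset_measure0 _ mN' _ N'0) => //.
  by move=> w [[a b] [_ ix]]; apply: sub => /= h; exact: (h b a ix).
have mE := measurable_preimage measurable_extend mN.
exists (extend @^-1` N); split=> //.
  rewrite /hp_marginal /distribution /pushforward /= -N0; congr (UOG _).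
  by apply/seteqP; split=> w /= /locN.
move=> w' /= /contrapT inf.
apply: (infinite_hp_cluster (w := extend w')).
rewrite (_ : hp_restriction _ = w') //; apply/funext => -[e he].
rewrite /hp_restriction /extend /=.
by case: pselect => [h|//]; congr w'; congr exist; exact: Prop_irrelevance.
Qed.
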